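(* Let $n\ge1$ be an integer and $0<s<n$. For $1\le p,q\le\infty$ with $\frac1p+\frac1q>\frac sn$, let $r$ be defined by $$\frac1r=\frac1p+\frac1q-\frac sn .$$ The following hold. (1) If $1<p,q<\infty$, then for every $\alpha>0$ with $\frac1\alpha>\frac1p+\frac1q$, the operator $\mathcal J_s$ is not bounded from $L^p(\mathbb R^n)\times L^q(\mathbb R^n)$ to $L^{r,\alpha}(\mathbb R^n)$. (2) If $1<p<\frac ns$ and $q\in\{1,\infty\}$, then for every $0<\alpha<p$, the operator $\mathcal J_s$ is not bounded from $L^p(\mathbb R^n)\times L^q(\mathbb R^n)$ to $L^{r,\alpha}(\mathbb R^n)$. (3) If $p=1$ and $q=\infty$, then for every $0<\alpha<\infty$, the operator $\mathcal J_s$ is not bounded from $L^1(\mathbb R^n)\times L^\infty(\mathbb R^n)$ to $L^{\frac n{n-s},\alpha}(\mathbb R^n)$.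
   Context: For $0<s<n$, $G_s$ denotes the Bessel kernel of order $s$ on $\mathbb R^n$: the nonnegative integrable function whose Fourier transform (with convention $\widehat{h}(\xi)=\int h(x)e^{-2\pi i x\cdot\xi}\,dx$) is $\widehat{G_s}(\xi)=(1+4\pi^2|\xi|^2)^{-s/2}$. The bilinear Bessel potential is $$\mathcal J_s(f,g)(x)=\int_{\mathbb R^n}G_s(y)\,f(x-y)\,g(x+y)\,dy .$$ Lorentz spaces: for a measurable $h$ on $\mathbb R^n$ let $d_h(\lambda)=|\{|h|>\lambda\}|$ and $h^*(t)=\inf\{\lambda>0: d_h(\lambda)\le t\}$. For $0<a<\infty$ and $0<b\le\infty$, $L^{a,b}(\mathbb R^n)$ consists of all $h$ with $\|h\|_{L^{a,b}}<\infty$, where $\|h\|_{L^{a,b}}=\left(\int_0^\infty (t^{1/a}h^*(t))^b\,\frac{dt}{t}\right)^{1/b}$ if $b<\infty$ and $\|h\|_{L^{a,\infty}}=\sup_{t>0}t^{1/a}h^*(t)$. Saying that $\mathcal J_s: X\times Y\to Z$ is bounded means that there is a finite constant $C$ such that, for all $f\in X$, $g\in Y$, the defining integral converges absolutely for a.e. $x$ and $\|\mathcal J_s(f,g)\|_Z\le C\|f\|_X\|g\|_Y$. Convention: $1/\infty=0$. *)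

(* Defs.v *)
From HB Require Import structures.
From mathcomp Require Import all_boot all_order all_algebra.
From mathcomp Require Import all_classical all_reals all_analysis.
From mathcomp.real_closed Require Import complex.

Set Implicit Arguments.
Unset Strict Implicit.
Unset Printing Implicit Defensive.
Import Order.TTheory GRing.Theory Num.Theory.
Import numFieldNormedType.Exports.
Local Open Scope classical_set_scope.
Local Open Scope ring_scope.

(* The sigma-algebra carried by n-tuples is the one generated by the
   coordinates, i.e. the Borel sigma-algebra of R^n. *)
Definition Rn (R : realType) (n : nat) : measurableType _ :=
  n.-tuple (measurableTypeR R).

Section euclidean.
Context {R : realType} {n : nat}.
Implicit Types x y : Rn R n.

Definition vadd x y : Rn R n := [tuple (tnth x i + tnth y i : R) | i < n].
Definition vsub x y : Rn R n := [tuple (tnth x i - tnth y i : R) | i < n].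
Definition dot x y : R := \sum_(i < n) (tnth x i * tnth y i : R).

End euclidean.

Section cons_measure.
Context {R : realType} {n : nat}.
Variable mu : {sigma_finite_measure set (Rn R n) -> \bar R}.

Definition consp (xt : measurableTypeR R * Rn R n) : Rn R n.+1 :=
  [tuple of xt.1 :: xt.2].

Lemma measurable_consp : measurable_fun [set: measurableTypeR R * Rn R n] consp.
Proof. exact: measurable_cons. Qed.

Definition cons_measure : set (Rn R n.+1) -> \bar R :=
  pushforward (lebesgue_measure \x mu)%E consp.

Let cons_measure0 : cons_measure set0 = 0%E.
Proof. by rewrite /cons_measure /pushforward preimage_set0 measure0. Qed.

Let cons_measure_ge0 A : (0 <= cons_measure A)%E.
Proof. exact: (measure_ge0 (lebesgue_measure \x mu)%E). Qed.

Let cons_measure_sigma_additive : semi_sigma_additive cons_measure.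
Proof.
exact: (@measure_semi_sigma_additive _ _ _
  (measure_function_pushforward__canonical__measure_function_Measure
    (lebesgue_measure \x mu)%E measurable_consp)).
Qed.

HB.instance Definition _ := isMeasure.Build _ _ _ cons_measure
  cons_measure0 cons_measure_ge0 cons_measure_sigma_additive.

Let cons_measure_sigma_finite : sigma_finite setT cons_measure.
Proof.
have /sigma_finiteP[F [TF ndF Foo]] := sigma_finiteT (@lebesgue_measure R).
have /sigma_finiteP[G [TG ndG Goo]] := sigma_finiteT mu.
pose unc (t : Rn R n.+1) : measurableTypeR R * Rn R n :=
  (thead t, [tuple of behead t]).
have munc : measurable_fun setT unc.
  apply/measurable_fun_pairP; split; first exact: measurable_tnth.
  exact: measurable_behead.
have uncK : unc \o consp = id.
  by apply/funext => -[x t]; congr pair; apply/val_inj.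
exists (fun k => unc @^-1` (F k `*` G k)).
  apply/esym/seteqP; split=> // t _.
  have [i _ Fi] : (\bigcup_i F i) (unc t).1 by rewrite -TF.
  have [j _ Gj] : (\bigcup_i G i) (unc t).2 by rewrite -TG.
  exists (maxn i j) => //; split.
    by move: Fi; exact/subsetPset/ndF/leq_maxl.
  by move: Gj; exact/subsetPset/ndG/leq_maxr.
move=> k; have [mF Fk] := Foo k; have [mG Gk] := Goo k; split.
  rewrite -[X in measurable X]setTI; apply: munc => //.
  exact: measurableX.
rewrite /cons_measure /pushforward -comp_preimage uncK preimage_id.
by rewrite product_measure1E// lte_mul_pinfty// ge0_fin_numE.
Qed.

HB.instance Definition _ := Measure_isSigmaFinite.Build _ _ _ cons_measure
  cons_measure_sigma_finite.

End cons_measure.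

Fixpoint leb (R : realType) (n : nat) :
    {sigma_finite_measure set (Rn R n) -> \bar R} :=
  match n with
  | 0 => \d_([tuple] : Rn R 0)
  | m.+1 => cons_measure (leb R m)
  end.

Lemma leb_box (R : realType) (n : nat) (A : 'I_n -> set (measurableTypeR R)) :
  (forall i, measurable (A i)) ->
  leb R n [set x | forall i, A i (tnth x i)] =
  (\prod_(i < n) lebesgue_measure (A i))%E.
Proof.
elim: n A => [|n IH] A mA /=.
  by rewrite big_ord0 diracE mem_set//= => -[].
rewrite big_ord_recl -(IH (fun i => A (lift ord0 i)))// -product_measure1E//.
  rewrite /cons_measure /pushforward; congr (_ _).
  apply/seteqP; split=> [[x t] /= At|[x t] /= [Ax At] i].
    split; first by have := At ord0.
    by move=> i; have := At (lift ord0 i); rewrite tnthS.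
  by case: (unliftP ord0 i) => [j ->|->//]; rewrite tnthS.
rewrite (_ : [set x | _] =
    \bigcap_(i in [set: 'I_n]) ((@tnth _ (measurableTypeR R))^~ i @^-1` A (lift ord0 i))); last first.
  by apply/seteqP; split=> x /= h i; [move=> _|]; exact: h.
apply: fin_bigcap_measurable => // i _.
by rewrite -[X in measurable X]setTI; exact: measurable_tnth.
Qed.

Section bilinear_bessel.
Local Open Scope complex_scope.
Context {R : realType} {n : nat}.
Implicit Types (f g h : Rn R n -> R[i]) (G : Rn R n -> R) (x y xi : Rn R n).

Definition cabs (z : R[i]) : R := ComplexField.Normc.normc z.

Definition expi (t : R) : R[i] := cos t +i* sin t.

Definition cmeasurable h :=
  measurable_fun setT (fun x => complex.Re (h x)) /\
  measurable_fun setT (fun x => complex.Im (h x)).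

Definition cintegrable h :=
  cmeasurable h /\ (\int[leb R n]_x (cabs (h x))%:E < +oo)%E.

Definition cintegral h : R[i] :=
  (\int[leb R n]_x complex.Re (h x)) +i* (\int[leb R n]_x complex.Im (h x)).

Definition fourier h xi : R[i] :=
  cintegral (fun x => h x * expi (- (2 * pi * dot x xi))).

(* This determines G up to a null set. *)
Definition is_bessel_kernel (s : R) G :=
  [/\ forall x, 0 <= G x,
      (leb R n).-integrable setT (EFin \o G) &
      forall xi, fourier (fun x => (G x)%:C) xi =
        ((1 + 4 * pi ^+ 2 * dot xi xi) `^ (- (s / 2)))%:C].

Definition bessel_integrand G f g x y : R[i] :=
  (G y)%:C * f (vsub x y) * g (vadd x y).

Definition bilinear_bessel G f g x : R[i] :=
  cintegral (bessel_integrand G f g x).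

Definition Lp_norm (p : \bar R) h : \bar R :=
  Lnorm (leb R n) p (fun x => (cabs (h x))%:E).

Definition distr_fun h (lambda : R) : \bar R :=
  leb R n [set x | lambda < cabs (h x)].

Definition rearrangement h (t : R) : \bar R :=
  ereal_inf [set lambda%:E | lambda in
    [set lambda : R | 0 < lambda /\ (distr_fun h lambda <= t%:E)%E]].

(* The second exponent ranges over ]0, +oo]; -oo is a junk value. *)
Definition lorentz_norm (a : R) (b : \bar R) h : \bar R :=
  match b with
  | b%:E => (\int[lebesgue_measure]_(t in `]0%R, +oo[)
      (((t `^ a^-1)%:E * rearrangement h t) `^ b * (t^-1)%:E)) `^ b^-1
  | _ => ereal_sup
      [set (t `^ a^-1)%:E * rearrangement h t | t in `]0%R, +oo[ ]
  end%E.

Definition in_space (N : (Rn R n -> R[i]) -> \bar R) h :=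
  cmeasurable h /\ (N h < +oo)%E.

(* Boundedness from X x Y to Z, with the spaces given by their
   (quasi-)norms. *)
Definition bessel_bounded G (NX NY NZ : (Rn R n -> R[i]) -> \bar R) :=
  exists C : R, forall f g, in_space NX f -> in_space NY g ->
    {ae leb R n, forall x, cintegrable (bessel_integrand G f g x)} /\
    (NZ (bilinear_bessel G f g) <= C%:E * (NX f * NY g))%E.

End bilinear_bessel.

(* Main.v *)
Require Import Defs.
From mathcomp Require Import all_boot all_order all_algebra.
From mathcomp Require Import all_classical all_reals all_analysis.
From mathcomp Require Import measurable_realfun ess_sup_inf ring lra.
From mathcomp.real_closed Require Import complex.

(** All three failures are logarithmic.  On the shell 2^-N <= |u| < 1, where
    |u| is the sup norm, the weight w = |u|^-n has integral O(N)
    [integral_shell_power], whereas a function h with h >= c |x|^(-n/r) on such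
    a shell satisfies h^*(t) >= c t^(-1/r) over a range of t of logarithmic
    length c N, so that its L^{r,alpha} norm is at least c' N^(1/alpha)
    [lorentz_norm_lower].  A bounded operator therefore cannot produce such an
    h from a pair whose product of norms is O(N^beta) with beta < 1/alpha
    [lorentz_blowup].

    The pairs are built from three bricks: w^(1/p) for a factor in L^p with
    p < oo, of norm O(N^(1/p)); the constant 1 for a factor in L^oo; and a
    narrow Gaussian for a factor in L^1, which imitates a point mass.  The three
    relevant combinations are

    - w^i and w^j, with i = 1/p, j = 1/q (j = 0 gives the constant 1), where
      beta = i + j [unbounded_shells];
    - w^i and a Gaussian, where beta = i [unbounded_shell_gauss];
    - a Gaussian and 1, where beta = 0 [unbounded_gauss_one].

    The lower bound c |x|^(-n/r) for the potential comes from the behaviour of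
    the Bessel kernel G near the origin.  For two shell weights, both factors
    are comparable to their values at x as long as |y| < |x|/2, and the G-mass
    of that ball is at least c |x|^s [bessel_ball_mass].  For a Gaussian, which
    concentrates at y = -x (or y = x), the factor seen is the average of G near
    that point, which is at least c |x|^(s-n) times the mass of the Gaussian
    [gauss_mean_lower_radial].

    Both facts have to be extracted from the Fourier transform of G alone, which
    fixes G only almost everywhere.  Averages of G against Gaussians are
    accessible: writing the Gaussian as a Fourier integral and the symbol
    (1 + 4 pi^2 |xi|^2)^(-s/2) as a Gamma integral of exponentials expresses
    such an average as an explicit integral over heat times t of positive terms
    [gauss_mean_heat], and the times t ~ tau of that integral give the bound
    [gauss_mean_lower].  The ball mass follows by comparing Gaussians of two
    widths [gauss_mean_doubling]. *)

Set Implicit Arguments.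
Unset Strict Implicit.
Unset Printing Implicit Defensive.
Import Order.TTheory GRing.Theory Num.Theory.
Import numFieldNormedType.Exports.
Local Open Scope classical_set_scope.
Local Open Scope ring_scope.

(** * Integrable real-valued functions *)

Section real_valued_integrals.
Context {d : measure_display} {T : measurableType d} {R : realType}.
Context {mu : {measure set T -> \bar R}}.
Implicit Types f g : T -> R.

Lemma rintegrableZ (k : R) f : mu.-integrable setT (EFin \o f) ->
  mu.-integrable setT (EFin \o (fun x => k * f x)).
Proof. by move=> /(integrableZl measurableT k). Qed.

Lemma rintegrableD f g : mu.-integrable setT (EFin \o f) ->
  mu.-integrable setT (EFin \o g) ->
  mu.-integrable setT (EFin \o (fun x => f x + g x)).
Proof. by move=> intf /(integrableD measurableT intf). Qed.

Lemma rintegrableB f g : mu.-integrable setT (EFin \o f) ->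
  mu.-integrable setT (EFin \o g) ->
  mu.-integrable setT (EFin \o (fun x => f x - g x)).
Proof. by move=> intf /(integrableB measurableT intf). Qed.

Lemma rintegrable_measurable f : mu.-integrable setT (EFin \o f) ->
  measurable_fun setT f.
Proof. by case/integrableP => /measurable_EFinP. Qed.

Lemma rintegrable_le f g : measurable_fun setT f ->
  (forall x, `|f x| <= g x) -> mu.-integrable setT (EFin \o g) ->
  mu.-integrable setT (EFin \o f).
Proof.
move=> mf fg intg; apply: (le_integrable measurableT _ _ intg).
  exact/measurable_EFinP.
by move=> x _ /=; rewrite lee_fin (le_trans (fg x))// ler_norm.
Qed.

Lemma rintegrableM_bounded f g (k : R) : mu.-integrable setT (EFin \o f) ->
  measurable_fun setT g -> (forall x, `|g x| <= k) ->
  mu.-integrable setT (EFin \o (fun x => f x * g x)).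
Proof.
move=> intf mg gk; apply: (@rintegrable_le _ (fun x => k * `|f x|)).
- by apply: measurable_funM => //; exact: rintegrable_measurable.
- by move=> x; rewrite normrM mulrC ler_wpM2r.
- exact/rintegrableZ/(integrable_abse intf).
Qed.

Lemma rintegrable_EFinE f : mu.-integrable setT (EFin \o f) ->
  (\int[mu]_x (f x)%:E)%E = (\int[mu]_x f x)%:E.
Proof. by move=> intf; rewrite /Rintegral fineK//; exact: integrable_fin_num. Qed.

End real_valued_integrals.

(** * The Fourier transform of a Gaussian on the line *)

Section gaussian_line.
Context {R : realType}.
Local Notation mu1 := (@lebesgue_measure R).

Lemma measurable_gauss1 (b : R) :
  measurable_fun setT (fun x : R => expR (- (b * x ^+ 2))).
Proof.
apply: measurableT_comp => //; apply: measurableT_comp => //.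
by apply: measurable_funM => //; exact: measurable_funX.
Qed.

(** The substitution x -> sqrt b * x reduces to the known case b = 1. *)
Lemma integral_gauss1 (b : R) : 0 < b ->
  (\int[mu1]_x (expR (- (b * x ^+ 2)))%:E = (Num.sqrt (pi / b))%:E)%E.
Proof.
move=> b0.
have sb0 : 0 < Num.sqrt b by rewrite sqrtr_gt0.
have dF (x : R) : is_derive x (1:R) (fun x : R => Num.sqrt b * x) (Num.sqrt b).
  by apply: is_derive_eq; rewrite scaler1 /GRing.scale /= ?mulr1.
have F'E : derive1 (fun x : R => Num.sqrt b * x) = cst (Num.sqrt b).
  by apply/funext => x; rewrite derive1E; apply: derive_val.
have := @increasing_ge0_integration_by_substitutionT R
   (fun x => Num.sqrt b * x) gauss_fun.
rewrite integralT_gauss F'E.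
have -> : (\int[mu1]_x ((((gauss_fun (R:=R) \o (fun x => Num.sqrt b * x)) *
      cst (Num.sqrt b)) x)%R)%:E =
    \int[mu1]_x ((Num.sqrt b)%:E * (expR (- (b * x ^+ 2)))%:E))%E.
  apply: eq_integral => x _; rewrite !fctE /= /gauss_fun.
  by rewrite exprMn sqr_sqrtr ?(ltW b0)// EFinM muleC.
rewrite ge0_integralZl_EFin//=; last by apply/measurable_EFinP;
  exact: measurable_gauss1.
move=> h; have {h} : (Num.sqrt pi)%:E =
  ((Num.sqrt b)%:E * (\int[mu1]_x (expR (- (b * x ^+ 2)))%:E))%E.
  apply: h.
  - by move=> x y xy; rewrite /= ltr_pM2l.
  - by move=> x; exact: cvg_cst.
  - exact: is_cvg_cst.
  - exact: is_cvg_cst.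
  - by move=> x; exact: ex_derive.
  - exact: gt0_cvgMrNy.
  - exact: gt0_cvgMry.
  - exact: continuous_gauss_fun.
  - exact: gauss_fun_ge0.
rewrite sqrtrM ?pi_ge0// sqrtrV ?(ltW b0)// => h.
rewrite EFinM h muleC muleA -EFinM mulVf ?mul1e// gt_eqF//.
Qed.

Lemma integrable_gauss1 (b : R) : 0 < b ->
  mu1.-integrable setT (EFin \o (fun x : R => expR (- (b * x ^+ 2)))).
Proof.
move=> b0; apply/integrableP; split.
  by apply/measurable_EFinP; exact: measurable_gauss1.
under eq_integral do rewrite /= ger0_norm ?expR_ge0//.
by rewrite integral_gauss1// ltry.
Qed.

Lemma Rintegral_gauss1 (b : R) : 0 < b ->
  \int[mu1]_x expR (- (b * x ^+ 2)) = Num.sqrt (pi / b).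
Proof. by move=> b0; rewrite /Rintegral integral_gauss1. Qed.

Lemma integrable_gauss1_moment (b : R) : 0 < b ->
  mu1.-integrable setT (EFin \o (fun x : R => `|x| * expR (- (b * x ^+ 2)))).
Proof.
move=> b0; have b20 : 0 < b / 2 by rewrite divr_gt0.
apply: (@rintegrable_le _ (measurableTypeR R) R mu1 _
  (fun x => expR (- (b * x ^+ 2)) + 2 / b * expR (- (b / 2 * x ^+ 2)))).
- by apply: measurable_funM; [exact: normr_measurable|exact: measurable_gauss1].
- move=> x; rewrite normrM normr_id (ger0_norm (expR_ge0 _)).
  (* Half of the exponential pays for the polynomial factor |x| <= 1 + x^2, by
     z e^(-z) <= 1 at z = b x^2 / 2. *)
  have -> : expR (- (b * x ^+ 2)) =
      expR (- (b / 2 * x ^+ 2)) * expR (- (b / 2 * x ^+ 2)).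
    by rewrite -expRD; congr expR; field.
  set E := expR (- (b / 2 * x ^+ 2)).
  have E0 : 0 < E by exact: expR_gt0.
  have hE : b / 2 * x ^+ 2 * E <= 1.
    rewrite /E expRN ler_pdivrMr ?expR_gt0// mul1r.
    by apply: le_trans (expR_ge1Dx _); rewrite lerDr.
  have hx : `|x| <= 1 + x ^+ 2.
    rewrite -(real_normK (num_real x)); have := sqr_ge0 (`|x| - 1).
    have := normr_ge0 x; nra.
  have h3 : x ^+ 2 * E <= 2 / b by rewrite ler_pdivlMr//; lra.
  have h4 : x ^+ 2 * E * E <= 2 / b * E by rewrite ler_pM2r.
  have h5 : `|x| * (E * E) <= (1 + x ^+ 2) * (E * E) by rewrite ler_pM2r// mulr_gt0.
  by lra.
- apply: rintegrableD; first exact: integrable_gauss1.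
  by apply: rintegrableZ; exact: integrable_gauss1.
Qed.

(** The fundamental theorem of calculus on [-k, k] leaves two boundary terms
    that vanish as k grows; dominated convergence passes to the whole line. *)
Lemma Rintegral_derive_eq0 (H h : R -> R) :
  (forall x : R, is_derive x (1 : R) H (h x)) -> continuous h ->
  mu1.-integrable setT (EFin \o h) ->
  H x @[x --> +oo%R] --> (0 : R) -> H x @[x --> -oo%R] --> (0 : R) ->
  \int[mu1]_x h x = 0.
Proof.
move=> dH ch ih Hy HNy.
pose trunc (k : nat) := (EFin \o h) \_ `[(- k.+1%:R : R), k.+1%:R]%classic.
have h1 : (\int[mu1]_x trunc k x @[k --> \oo] --> \int[mu1]_x (h x)%:E)%E.
  apply: (@dominated_cvg _ _ _ mu1 setT measurableT trunc (EFin \o h)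
    (abse \o (EFin \o h))) => //.
  - move=> k; apply/(measurable_restrictT _ _).1 => //.
    by apply: measurable_funTS; case/integrableP: ih.
  - move=> x _; apply: cvg_near_cst.
    have [m mx] : exists m : nat, `|x| <= m%:R.
      by exists (Num.truncn `|x|).+1; rewrite ltW// truncnS_gt.
    exists m => // k /= mk; rewrite /trunc patchE mem_set//=.
    rewrite in_itv/= -ler_norml (le_trans mx)// ler_nat.
    by rewrite (leq_trans mk).
  - exact: integrable_abse.
  - move=> k x _; rewrite /trunc patchE; case: ifP => // _.
    by rewrite [point]/(0%E) abse0 /=.
have h2 : (\int[mu1]_x trunc k x @[k --> \oo] --> 0)%E.
  have -> : (fun k => \int[mu1]_x trunc k x)%E =
      (fun k => (H k.+1%:R - H (- k.+1%:R))%:E).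
    apply/funext => k; rewrite /trunc -integral_mkcond.
    have dH' (x : R) : derivable H x 1 by apply: ex_derive.
    have cH : continuous H by move=> x; apply: differentiable_continuous;
      exact/derivable1_diffP.
    rewrite (@continuous_FTC2 _ h H) ?EFinB//.
    + by rewrite gtrN// ltr0n.
    + by apply: continuous_subspaceT.
    + split=> [x _//||].
      * exact/cvg_at_right_filter/cH.
      * exact/cvg_at_left_filter/cH.
    + by move=> x _; rewrite derive1E derive_val.
  rewrite -[0%E]/((0%R)%:E); apply: cvg_EFin; first exact: nearW.
  rewrite -[X in _ --> X]subr0; apply: cvgB.
    have := @cvgr_idn R; move/(cvg_comp _ _)/(_ Hy).
    by rewrite -(cvg_shiftn 1) => h2; under eq_fun do rewrite -addn1.
  have : (fun n : nat => - (n%:R : R)) k @[k --> \oo] --> -oo.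
    by apply/cvgNrNy; exact: cvgr_idn.
  move/(cvg_comp _ _)/(_ HNy).
  by rewrite -(cvg_shiftn 1) => h2; under eq_fun do rewrite -addn1.
by rewrite /Rintegral (cvg_unique _ h1 h2).
Qed.

Lemma gauss_bounded_cvg0 (b : R) (v : R -> R) : 0 < b -> (forall x, `|v x| <= 1) ->
  expR (- (b * x ^+ 2)) * v x @[x --> +oo%R] --> (0 : R).
Proof.
move=> b0 v1.
have E0 : expR (- (b * x ^+ 2)) @[x --> +oo%R] --> (0:R).
  apply: (cvg_comp (fun x => b * x ^+ 2) (fun x => expR (- x)));
    last exact: cvgr_expR.
  by apply: gt0_cvgMry => //; exact: cvgr_expr2.
apply/norm_cvg0P.
apply: (squeeze_cvgr (f := fun=> 0) (h := fun x => expR (- (b * x ^+ 2)))) => //.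
  apply: nearW => x; rewrite normr_ge0 normrM ger0_norm ?expR_ge0//.
  by rewrite ler_piMr ?expR_ge0.
exact: cvg_cst.
Qed.

Definition gauss_cos (b y : R) : R :=
  \int[mu1]_x (expR (- (b * x ^+ 2)) * cos (y * x)).

Lemma measurable_cos : measurable_fun setT (@cos R).
Proof. by apply: continuous_measurable_fun; exact: continuous_cos. Qed.

Lemma measurable_sin : measurable_fun setT (@sin R).
Proof. by apply: continuous_measurable_fun; exact: continuous_sin. Qed.

Lemma norm_cos_le1 (x : R) : `|cos x| <= 1.
Proof. by rewrite ler_norml cos_geN1 cos_le1. Qed.

Lemma norm_sin_le1 (x : R) : `|sin x| <= 1.
Proof. by rewrite ler_norml sin_geN1 sin_le1. Qed.

Lemma integrable_gauss_cos (b y : R) : 0 < b ->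
  mu1.-integrable setT (EFin \o (fun x => expR (- (b * x ^+ 2)) * cos (y * x))).
Proof.
move=> b0; apply: (rintegrableM_bounded (k := 1)) => [||x].
- exact: integrable_gauss1.
- by apply: (measurableT_comp measurable_cos); exact: measurable_funM.
- exact: norm_cos_le1.
Qed.

Lemma integrable_gauss_sin (b y : R) : 0 < b ->
  mu1.-integrable setT (EFin \o (fun x => expR (- (b * x ^+ 2)) * sin (y * x))).
Proof.
move=> b0; apply: (rintegrableM_bounded (k := 1)) => [||x].
- exact: integrable_gauss1.
- by apply: (measurableT_comp measurable_sin); exact: measurable_funM.
- exact: norm_sin_le1.
Qed.

Lemma integrable_gauss_xsin (b y : R) : 0 < b ->
  mu1.-integrable setT (EFin \o (fun x => x * expR (- (b * x ^+ 2)) * sin (y * x))).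
Proof.
move=> b0; apply: (rintegrableM_bounded (k := 1)) => [||x].
- apply: rintegrable_le (integrable_gauss1_moment b0).
  + by apply: measurable_funM => //; exact: measurable_gauss1.
  + by move=> x; rewrite normrM (ger0_norm (expR_ge0 _)).
- by apply: (measurableT_comp measurable_sin); exact: measurable_funM.
- exact: norm_sin_le1.
Qed.

(** The difference of the two sides is the integral of the derivative of
    - e^(-b x^2) sin(y x), which vanishes at both ends. *)
Lemma gauss_cos_by_parts (b y : R) : 0 < b ->
  2 * b * \int[mu1]_x (x * expR (- (b * x ^+ 2)) * sin (y * x)) = y * gauss_cos b y.
Proof.
move=> b0; apply/eqP; rewrite -subr_eq0; apply/eqP.
rewrite /gauss_cos -!RintegralZl// ?integrable_gauss_xsin// ?integrable_gauss_cos//.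
rewrite -RintegralB//; last 2 first.
- exact/rintegrableZ/integrable_gauss_xsin.
- exact/rintegrableZ/integrable_gauss_cos.
have dH (x : R) : is_derive x (1:R)
    (fun x : R => - (expR (- (b * x ^+ 2)) * sin (y * x)))
    (2 * b * (x * expR (- (b * x ^+ 2)) * sin (y * x)) -
      y * (expR (- (b * x ^+ 2)) * cos (y * x))).
  apply: is_derive_eq; rewrite /GRing.scale /=; ring.
apply: Rintegral_derive_eq0 dH _ _ _ _.
- move=> x; apply: differentiable_continuous; apply/derivable1_diffP;
  exact: ex_derive.
- by apply: rintegrableB;
    [exact/rintegrableZ/integrable_gauss_xsin|exact/rintegrableZ/integrable_gauss_cos].
- rewrite -oppr0; apply: cvgN; apply: gauss_bounded_cvg0 => // x;
  exact: norm_sin_le1.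
- apply/cvgNy_compNP; rewrite /comp.
  under eq_fun do rewrite sqrrN mulrN sinN mulrN opprK.
  apply: gauss_bounded_cvg0 => // x; exact: norm_sin_le1.
Qed.

(** Differentiation under the integral sign brings down - x sin(y x); the
    derivative is dominated by |x| e^(-b x^2) uniformly in y, and integration
    by parts turns it back into gauss_cos. *)
Lemma is_derive_gauss_cos (b y : R) : 0 < b ->
  is_derive y (1 : R) (gauss_cos b) (- (y / (2 * b)) * gauss_cos b y).
Proof.
move=> b0.
pose f (y x : R) : R := expR (- (b * x ^+ 2)) * cos (y * x).
pose f' (y x : R) : R := - (x * expR (- (b * x ^+ 2)) * sin (y * x)).
have df (z x : R) : is_derive z (1 : R) (f ^~ x) (f' z x).
  by apply: is_derive_eq; rewrite /f' /GRing.scale /=; ring.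
have d1f (z x : R) : partial1of2 f z x = f' z x.
  by rewrite partial1of2E; apply: derive_val.
pose g (x : R) := `|x| * expR (- (b * x ^+ 2)).
have Iy : `]y - 1, y + 1[%classic y by rewrite /= in_itv/= ltrBlDr ltrDl ltr01.
have intf (x : R) : `]y - 1, y + 1[%classic x -> mu1.-integrable setT (EFin \o f x).
  by move=> _; exact: integrable_gauss_cos.
have derf (z x : R) : `]y - 1, y + 1[%classic z -> setT x -> derivable (f ^~ x) z 1.
  by move=> _ _; apply: ex_derive.
have g0 (x : R) : 0 <= g x by rewrite mulr_ge0 ?expR_ge0.
have fg (z x : R) : `]y - 1, y + 1[%classic z -> setT x ->
    `|partial1of2 f z x| <= g x.
  move=> _ _; rewrite d1f normrN 2!normrM (ger0_norm (expR_ge0 _)).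
  by rewrite ler_piMr ?g0// norm_sin_le1.
have intg : mu1.-integrable setT (EFin \o g) by exact: integrable_gauss1_moment.
have D := @derivable_under_integral _ _ _ mu1 f setT measurableT y _ _ Iy intf
  derf g g0 intg fg.
have E := @differentiation_under_integral _ _ _ mu1 f setT measurableT y _ _ Iy
  intf derf g g0 intg fg.
apply: DeriveDef => //.
rewrite -derive1E E.
under eq_Rintegral do rewrite d1f /f' -mulN1r.
rewrite RintegralZl ?integrable_gauss_xsin//.
have b20 : 2 * b != 0 by rewrite gt_eqF// mulr_gt0.
by apply: (mulfI b20); rewrite mulrCA gauss_cos_by_parts//; field; rewrite gt_eqF.
Qed.

(** The differential equation of gauss_cos says that its product with
    e^(y^2 / 4b) is constant; the constant is read off at y = 0. *)
Lemma gauss_cosE (b y : R) : 0 < b ->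
  gauss_cos b y = Num.sqrt (pi / b) * expR (- (y ^+ 2 / (4 * b))).
Proof.
move=> b0.
pose Q (y : R) := gauss_cos b y * expR (y ^+ 2 / (4 * b)).
have dQ (z : R) : is_derive z (1 : R) Q 0.
  have := is_derive_gauss_cos z b0 => ?.
  by apply: is_derive_eq; rewrite /GRing.scale /=; field; rewrite gt_eqF.
have := is_derive_0_is_cst y 0 dQ.
rewrite /Q {2}/gauss_cos expr0n/= mul0r expR0 mulr1.
under eq_Rintegral do rewrite mul0r cos0 mulr1.
rewrite Rintegral_gauss1// => <-.
by rewrite -mulrA -expRD subrr expR0 mulr1.
Qed.

(** The integrand is odd. *)
Lemma gauss_sin0 (b y : R) : 0 < b ->
  \int[mu1]_x (expR (- (b * x ^+ 2)) * sin (y * x)) = 0.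
Proof.
move=> b0.
set h := fun x : R => expR (- (b * x ^+ 2)) * sin (y * x).
have ih := integrable_gauss_sin y b0.
have hN (x : R) : h (- x) = - h x by rewrite /h sqrrN mulrN sinN mulrN.
have mh : measurable_fun setT (EFin \o h) by case/integrableP: ih.
have mN : measurable_fun setT (-%R : measurableTypeR R -> measurableTypeR R).
  exact: oppr_measurable.
have ihN : mu1.-integrable (-%R @^-1` setT) ((EFin \o h) \o -%R).
  rewrite (_ : _ \o _ = EFin \o (fun x => -1 * h x)); first exact: rintegrableZ.
  by apply/funext => x /=; rewrite hN mulN1r.
have e : \int[mu1]_x h x = - \int[mu1]_x h x.
  rewrite -[RHS]mulN1r -RintegralZl//.
  under [RHS]eq_Rintegral do rewrite mulN1r -hN.
  rewrite /Rintegral; congr fine.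
  rewrite -(integral_pushforward mN mh ihN measurableT).
  by apply: eq_measure_integral => A mA _; exact/esym/lebesgue_measureN.
by apply/eqP; move/eqP: e; rewrite -addr_eq0 -mulr2n mulrn_eq0.
Qed.
End gaussian_line.

(** * Integrals on products *)

Section product_integrals.
Context {d1 d2 : measure_display} {T1 : measurableType d1}
  {T2 : measurableType d2} {R : realType}.
Context {m1 : {sigma_finite_measure set T1 -> \bar R}}
  {m2 : {sigma_finite_measure set T2 -> \bar R}}.
Variables (u : T1 -> R) (v : T2 -> R).
Hypotheses (intu : m1.-integrable setT (EFin \o u))
  (intv : m2.-integrable setT (EFin \o v)).

Lemma integrable_tensor :
  (m1 \x m2)%E.-integrable setT (EFin \o (fun z => u z.1 * v z.2)).
Proof.
have mu := rintegrable_measurable intu; have mv := rintegrable_measurable intv.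
apply/integrable12ltyP.
  apply/measurable_EFinP; apply: measurable_funM.
    exact: measurableT_comp mu measurable_fst.
  exact: measurableT_comp mv measurable_snd.
under eq_integral => x _.
  under eq_integral do rewrite /= normrM EFinM.
  rewrite ge0_integralZl_EFin//; last first.
    by apply/measurable_EFinP; exact: measurableT_comp.
  over.
have /integrableP[_ iv] := intv; have /integrableP[_ iu] := intu.
rewrite ge0_integralZr//=.
- by rewrite lte_mul_pinfty// ?integral_ge0// ge0_fin_numE ?integral_ge0.
- by apply/measurable_EFinP; exact: measurableT_comp.
- exact: integral_ge0.
Qed.

Lemma Rintegral_tensor :
  \int[(m1 \x m2)%E]_z (u z.1 * v z.2) = (\int[m1]_x u x) * (\int[m2]_y v y).
Proof.
rewrite /Rintegral -(integral12_prod_meas1 integrable_tensor) /fubini_F/=.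
under eq_integral => x _.
  under eq_integral do rewrite EFinM.
  rewrite integralZl// -[X in (_ * X)%E]fineK; last exact: integrable_fin_num.
  rewrite muleC.
  over.
by rewrite integralZl//= fineM//=; [rewrite mulrC|exact: integrable_fin_num].
Qed.

(** The domination by u x * v y holds at every point, so that all inner
    integrals are finite and the exchange can be stated for real-valued
    integrals, with no exceptional set. *)
Lemma Rintegral_swap (F : T1 -> T2 -> R) :
  measurable_fun setT (fun z : T1 * T2 => F z.1 z.2) ->
  (forall x y, `|F x y| <= u x * v y) ->
  \int[m1]_x \int[m2]_y F x y = \int[m2]_y \int[m1]_x F x y.
Proof.
move=> mF Fuv.
have intF : (m1 \x m2)%E.-integrable setT (EFin \o (fun z => F z.1 z.2)).
  by apply: rintegrable_le integrable_tensor.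
have intF1 x : m2.-integrable setT (EFin \o F x).
  apply: rintegrable_le (Fuv x) (rintegrableZ _ intv).
  exact: measurableT_comp mF (pair1_measurable x).
have intF2 y : m1.-integrable setT (EFin \o F^~ y).
  apply: (@rintegrable_le _ _ _ _ _ (fun x => v y * u x)); last exact: rintegrableZ.
    exact: measurableT_comp mF (pair2_measurable y).
  by move=> x; rewrite mulrC.
rewrite /Rintegral; congr fine.
transitivity (\int[m1]_x \int[m2]_y (F x y)%:E)%E.
  by apply: eq_integral => x _; rewrite fineK// integrable_fin_num// intF1.
rewrite (Fubini intF); apply: eq_integral => y _.
by rewrite fineK// integrable_fin_num// intF2.
Qed.

End product_integrals.

Section cons_integrals.
Context {R : realType} {n : nat}.
Implicit Types (u : R -> R) (v : Rn R n -> R).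

Definition tailv (x : Rn R n.+1) : Rn R n := [tuple of behead x].

Lemma measurable_tailv : measurable_fun setT tailv.
Proof. exact: measurable_behead. Qed.

Lemma measurable_thead : measurable_fun setT (fun x : Rn R n.+1 => thead x : R).
Proof. exact: measurable_tnth. Qed.

Lemma tailv_consp (z : measurableTypeR R * Rn R n) : tailv (consp z) = z.2.
Proof. exact: val_inj. Qed.

Variables (u : R -> R) (v : Rn R n -> R).
Hypotheses (intu : (@lebesgue_measure R).-integrable setT (EFin \o u))
  (intv : (leb R n).-integrable setT (EFin \o v)).

Let consE (z : measurableTypeR R * Rn R n) :
  u (thead (consp z)) * v (tailv (consp z)) = u z.1 * v z.2.
Proof. by rewrite tailv_consp theadE. Qed.

Let mw : measurable_fun setT
  (EFin \o (fun x : Rn R n.+1 => u (thead x) * v (tailv x))).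
Proof.
apply/measurable_EFinP; apply: measurable_funM.
  exact: measurableT_comp (rintegrable_measurable intu) measurable_thead.
exact: measurableT_comp (rintegrable_measurable intv) measurable_tailv.
Qed.

Let intw : (lebesgue_measure \x leb R n)%E.-integrable (consp @^-1` setT)
  ((EFin \o (fun x : Rn R n.+1 => u (thead x) * v (tailv x))) \o consp).
Proof.
rewrite preimage_setT.
apply: eq_integrable (integrable_tensor intu intv) => //.
by move=> z _ /=; rewrite consE.
Qed.

Lemma integrable_cons : (leb R n.+1).-integrable setT
  (EFin \o (fun x => u (thead x) * v (tailv x))).
Proof.
have := integrable_pushforward measurable_consp mw intw measurableT.
move=> /integrableP[m i]; apply/integrableP; split=> //.
Qed.

(** The measure leb R n.+1 is the image of the product measure under consp, so
    this is a change of variables followed by the product formula. *)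
Lemma Rintegral_cons : \int[leb R n.+1]_x (u (thead x) * v (tailv x)) =
  (\int[lebesgue_measure]_x u x) * (\int[leb R n]_y v y).
Proof.
rewrite -(Rintegral_tensor intu intv) /Rintegral; congr fine.
transitivity (\int[pushforward (lebesgue_measure \x leb R n)%E consp]_x
  (u (thead x) * v (tailv x))%:E)%E; first by [].
rewrite (integral_pushforward measurable_consp mw intw)//.
by apply: eq_integral => z _; rewrite /= consE.
Qed.

End cons_integrals.

(** * The Fourier transform of a Gaussian on R^n *)

Section gaussian_fourier_Rn.
Context {R : realType}.

Lemma dot_cons n (x y : Rn R n.+1) :
  dot x y = thead x * thead y + dot (tailv x) (tailv y).
Proof.
rewrite /dot big_ord_recl; congr (_ + _); apply: eq_bigr => i _.
have e (z : Rn R n.+1) : tnth z (lift ord0 i) = tnth (tailv z) i.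
  by rewrite [in LHS](tuple_eta z) tnthS.
by rewrite !e.
Qed.

Lemma dot_ge0 n (x : Rn R n) : 0 <= dot x x.
Proof. by apply: sumr_ge0 => i _; rewrite -expr2 sqr_ge0. Qed.

Lemma measurable_fun_dot d (T : measurableType d) n (f g : T -> Rn R n) :
  measurable_fun setT f -> measurable_fun setT g ->
  measurable_fun setT (fun t => dot (f t) (g t)).
Proof.
move=> mf mg; apply: measurable_sum => i; apply: measurable_funM.
  exact: measurableT_comp (measurable_tnth i) mf.
exact: measurableT_comp (measurable_tnth i) mg.
Qed.

Definition gauss n (b : R) (x : Rn R n) : R := expR (- (b * dot x x)).

Lemma measurable_gauss n b : measurable_fun setT (@gauss n b).
Proof.
apply: measurableT_comp => //; apply: measurableT_comp => //.
by apply: measurable_funM => //; exact: measurable_fun_dot.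
Qed.

Lemma gauss_ge0 n b (x : Rn R n) : 0 <= gauss b x.
Proof. exact: expR_ge0. Qed.

Lemma gauss_le1 n b (x : Rn R n) : 0 <= b -> gauss b x <= 1.
Proof. by move=> b0; rewrite -expR0 ler_expR oppr_le0 mulr_ge0 ?dot_ge0. Qed.

Lemma gauss_cons n b (x : Rn R n.+1) :
  gauss b x = expR (- (b * thead x ^+ 2)) * gauss b (tailv x).
Proof. by rewrite /gauss dot_cons -expRD expr2 mulrDr opprD. Qed.

Lemma integrable_gauss n b : 0 < b ->
  (leb R n).-integrable setT (EFin \o (@gauss n b)).
Proof.
move=> b0; elim: n => [|n IH]; last first.
  rewrite (_ : gauss b = fun x => expR (- (b * thead x ^+ 2)) * gauss b (tailv x)).
    by apply: integrable_cons (integrable_gauss1 b0) IH.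
  by apply/funext => x; exact: gauss_cons.
apply/integrableP; split; first by apply/measurable_EFinP; exact: measurable_gauss.
rewrite integral_dirac//; first by rewrite diracT mul1e ltry.
by apply: measurableT_comp => //; apply/measurable_EFinP; exact: measurable_gauss.
Qed.

Lemma integrable_gauss_trig n b (w : R -> R) k (x : Rn R n) : 0 < b ->
  measurable_fun setT w -> (forall t, `|w t| <= 1) ->
  (leb R n).-integrable setT (EFin \o (fun y => gauss b y * w (k * dot x y))).
Proof.
move=> b0 mw w1; apply: (@rintegrableM_bounded _ _ _ _ _ _ 1) => //.
  exact: integrable_gauss.
apply: measurableT_comp => //; apply: measurable_funM => //.
by apply: measurable_fun_dot.
Qed.

(** Induction on the dimension. The addition formula for the cosine splits the
    integrand into two tensor products; the product of sines integrates to 0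
    because its one-dimensional factor is odd. In dimension 0 the measure is a
    Dirac mass. *)
Lemma gauss_fourier n b k (x : Rn R n) : 0 < b ->
  \int[leb R n]_y (gauss b y * cos (k * dot x y)) =
  Num.sqrt (pi / b) ^+ n * expR (- (k ^+ 2 * dot x x / (4 * b))).
Proof.
move=> b0; elim: n x => [|n IH] x.
  rewrite /Rintegral integral_dirac//=.
    rewrite indicT mul1r /gauss /dot !big_ord0 !mulr0 oppr0 cos0 expR0.
    by rewrite mul0r oppr0 expR0 expr0 mulr1.
  apply/measurable_EFinP; apply: measurable_funM; first exact: measurable_gauss.
  apply: measurableT_comp; first exact: measurable_cos.
  by apply: measurable_funM => //; exact: measurable_fun_dot.
set t := thead x; set x' := tailv x.
pose c (y : R) := expR (- (b * y ^+ 2)) * cos (k * t * y).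
pose s (y : R) := expR (- (b * y ^+ 2)) * sin (k * t * y).
pose c' (y : Rn R n) := gauss b y * cos (k * dot x' y).
pose s' (y : Rn R n) := gauss b y * sin (k * dot x' y).
have ic := integrable_gauss_cos (k * t) b0;
  have is_ := integrable_gauss_sin (k * t) b0.
have ic' := integrable_gauss_trig k x' b0 measurable_cos (@norm_cos_le1 R).
have is' := integrable_gauss_trig k x' b0 measurable_sin (@norm_sin_le1 R).
transitivity (\int[leb R n.+1]_y (c (thead y) * c' (tailv y) -
  s (thead y) * s' (tailv y))).
  apply: eq_Rintegral => y _; rewrite gauss_cons dot_cons mulrDr cosD /c /c' /s /s'.
  by rewrite -!mulrA; ring.
rewrite RintegralB//; [|exact: integrable_cons|exact: integrable_cons].
rewrite (Rintegral_cons ic ic') (Rintegral_cons is_ is') gauss_sin0//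
  mul0r subr0 IH.
rewrite -/(gauss_cos b (k * t)) gauss_cosE//
  [_ ^+ n.+1]exprS mulrACA -expRD dot_cons -/t -/x'.
by congr (_ * expR _); field; rewrite gt_eqF.
Qed.

End gaussian_fourier_Rn.

(** * The sup norm *)

Section sup_norm.
Context {R : realType} {n : nat}.
Implicit Types (x y : Rn R n) (r : R).

(** The sup norm replaces the Euclidean norm throughout: its balls are boxes,
    whose measure is known exactly, and the two norms agree up to a factor
    sqrt n, which only affects constants. *)
Definition supn x : R := \big[Num.max/0]_(i < n) `|tnth x i : R|.

Lemma supn_ge0 x : 0 <= supn x.
Proof. by rewrite /supn; exact: bigmax_ge_id. Qed.

Lemma ler_supn x i : `|tnth x i : R| <= supn x.
Proof. exact: (le_bigmax _ (fun i => `|tnth x i : R|)). Qed.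

Lemma supn_leP x r : 0 <= r ->
  reflect (forall i, `|tnth x i : R| <= r) (supn x <= r).
Proof.
move=> r0; apply: (iffP (bigmax_leP _ _ _ _)) => [[_ h] i|h]; first exact: h.
by split=> // i _; exact: h.
Qed.

Lemma supn_ltP x r : 0 < r -> reflect (forall i, `|tnth x i : R| < r) (supn x < r).
Proof.
move=> r0; apply: (iffP (bigmax_ltP _ _ _ _)) => [[_ h] i|h]; first exact: h.
by split=> // i _; exact: h.
Qed.

Lemma measurable_supn : measurable_fun setT supn.
Proof.
rewrite /supn; elim: (index_enum _) => [|i l IH].
  by rewrite (_ : (fun _ => _) = cst 0)//; apply/funext => x; rewrite big_nil.
rewrite (_ : (fun _ => _) = fun x : Rn R n => Num.max `|tnth x i : R|
    (\big[Num.max/0]_(j <- l) `|tnth x j : R|)); last first.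
  by apply/funext => x; rewrite big_cons.
apply: measurable_maxr => //; apply: measurableT_comp;
  first exact: normr_measurable.
exact: measurable_tnth.
Qed.

Lemma measurable_supn_lt r : measurable [set x | supn x < r].
Proof.
rewrite -[X in measurable X]setTI (_ : [set x | _] = supn @^-1` `]-oo, r[%classic).
  by apply: measurable_supn.
by apply/seteqP; split=> x /=; rewrite in_itv.
Qed.

Lemma leb_supn_lt r : 0 < r -> leb R n [set x | supn x < r] = ((2 * r) ^+ n)%:E.
Proof.
move=> r0.
rewrite (_ : [set x | _] = [set x : Rn R n | forall i,
    `](- r), r[%classic (tnth x i : R)]).
  rewrite (@leb_box R n (fun=> `](- r), r[%classic))//.
  rewrite (eq_bigr (fun=> (2 * r)%:E)).
    by rewrite -[in RHS](card_ord n) -prodr_const -prodEFin.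
  move=> i _; rewrite lebesgue_measure_itv/= lte_fin gtrN//.
  by rewrite -EFinD opprK mulr_natl mulr2n.
apply/seteqP; split=> x /=.
  by move=> /(supn_ltP _ r0) h i; rewrite in_itv/= -ltr_norml.
by move=> h; apply/(supn_ltP _ r0) => i; have := h i; rewrite in_itv/= -ltr_norml.
Qed.

Lemma sqr_supn_le_dot x : supn x ^+ 2 <= dot x x.
Proof.
have sd i : `|tnth x i : R| ^+ 2 <= dot x x.
  rewrite /dot (bigD1 i)//= real_normK ?num_real// expr2 lerDl.
  by apply: sumr_ge0 => j _; rewrite -expr2 sqr_ge0.
have : supn x <= Num.sqrt (dot x x).
  apply/supn_leP; first exact: sqrtr_ge0.
  by move=> i; rewrite -[leLHS]ger0_norm// -sqrtr_sqr ler_wsqrtr.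
by rewrite -(@ler_pXn2r _ 2)// ?nnegrE ?supn_ge0 ?sqrtr_ge0// sqr_sqrtr ?dot_ge0.
Qed.

Lemma dot_le_supn x : dot x x <= n%:R * supn x ^+ 2.
Proof.
rewrite /dot -[X in X%:R * _](card_ord n) mulr_natl -sumr_const;
  apply: ler_sum => i _.
rewrite -expr2 -(real_normK (num_real _)) ler_pXn2r// ?nnegrE ?supn_ge0//.
exact: ler_supn.
Qed.

Lemma supn_vadd x y : supn (vadd x y) <= supn x + supn y.
Proof.
apply/supn_leP => [|i]; first by rewrite addr_ge0 ?supn_ge0.
by rewrite tnth_mktuple (le_trans (ler_normD _ _))// lerD ?ler_supn.
Qed.

Definition vopp x : Rn R n := [tuple (- (tnth x i) : R) | i < n].
Definition vzero : Rn R n := [tuple (0 : R) | i < n].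

Lemma supn_vopp x : supn (vopp x) = supn x.
Proof. by apply: eq_bigr => i _; rewrite tnth_mktuple normrN. Qed.

Lemma vsubE x y : vsub x y = vadd x (vopp y).
Proof. by apply: eq_from_tnth => i; rewrite !tnth_mktuple. Qed.

Lemma vadd0 y : vadd vzero y = y.
Proof. by apply: eq_from_tnth => i; rewrite !tnth_mktuple add0r. Qed.

Lemma dot0v y : dot vzero y = 0.
Proof. by rewrite /dot big1// => i _; rewrite tnth_mktuple mul0r. Qed.

Lemma dot_vaddl (x y z : Rn R n) : dot (vadd x y) z = dot x z + dot y z.
Proof.
rewrite /dot -big_split; apply: eq_bigr => i _ /=.
by rewrite tnth_mktuple mulrDl.
Qed.

Lemma measurable_vadd d (T : measurableType d) (f g : T -> Rn R n) :
  measurable_fun setT f -> measurable_fun setT g ->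
  measurable_fun setT (fun t => vadd (f t) (g t)).
Proof.
move=> mf mg; apply/measurable_fun_tnthP => i.
rewrite (_ : _ \o _ = fun t => tnth (f t) i + tnth (g t) i : R); last first.
  by apply/funext => t /=; rewrite tnth_mktuple.
apply: measurable_funD.
  exact: measurableT_comp (measurable_tnth i) mf.
exact: measurableT_comp (measurable_tnth i) mg.
Qed.

Lemma measurable_vsub d (T : measurableType d) (f g : T -> Rn R n) :
  measurable_fun setT f -> measurable_fun setT g ->
  measurable_fun setT (fun t => vsub (f t) (g t)).
Proof.
move=> mf mg; apply/measurable_fun_tnthP => i.
rewrite (_ : _ \o _ = fun t => tnth (f t) i - tnth (g t) i : R); last first.
  by apply/funext => t /=; rewrite tnth_mktuple.
apply: measurable_funB.
  exact: measurableT_comp (measurable_tnth i) mf.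
exact: measurableT_comp (measurable_tnth i) mg.
Qed.

Lemma supn_vsub x y : supn (vsub x y) <= supn x + supn y.
Proof. by rewrite vsubE -(supn_vopp y) supn_vadd. Qed.

Lemma supn_vadd_ge x y : supn x - supn y <= supn (vadd x y).
Proof.
have {1}<- : vsub (vadd x y) y = x.
  by apply: eq_from_tnth => i; rewrite !tnth_mktuple addrK.
by rewrite lerBlDr supn_vsub.
Qed.

Lemma supn_vsub_ge x y : supn x - supn y <= supn (vsub x y).
Proof. by rewrite vsubE -(supn_vopp y) supn_vadd_ge. Qed.

Lemma supn_double x : supn (vadd x x) = 2 * supn x.
Proof.
apply/eqP; rewrite eq_le mulr_natl mulr2n supn_vadd /=.
have : supn x <= supn (vadd x x) / 2.
  apply/supn_leP => [|i]; first by rewrite divr_ge0 ?supn_ge0.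
  have := ler_supn (vadd x x) i; rewrite tnth_mktuple -mulr2n normrMn.
  by rewrite ler_pdivlMr// mulr_natr.
by lra.
Qed.

End sup_norm.

(** * The Gamma integral in logarithmic coordinates *)

Section gamma_integral.
Context {R : realType}.
Local Notation mu1 := (@lebesgue_measure R).

Lemma integrable_reflect (f : R -> R) : mu1.-integrable setT (EFin \o f) ->
  mu1.-integrable setT (EFin \o (fun x => f (- x))).
Proof.
have mN : measurable_fun setT (-%R : measurableTypeR R -> measurableTypeR R).
  exact: oppr_measurable.
move=> /[dup] intf /integrableP[mf iltf]; apply/integrableP; split.
  exact: measurableT_comp mf mN.
rewrite (le_lt_trans _ iltf)// le_eqVlt; apply/orP; left; apply/eqP.
transitivity (\int[pushforward mu1 (-%R : measurableTypeR R -> measurableTypeR R)]_x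
  `|(EFin \o f) x|)%E.
  rewrite (ge0_integral_pushforward mN)//=.
  by apply/measurable_EFinP; apply: measurableT_comp => //; exact/measurable_EFinP.
by apply: eq_measure_integral => A mA _; exact: lebesgue_measureN.
Qed.

(** The integrand t^a e^(-l t) dt/t of the Gamma integral at t = e^u. In this
    coordinate the domain is the whole line, the integrand is smooth, and a
    scaling of l is a translation of u. *)
Definition gamma_kernel (a l u : R) : R := expR (a * u - l * expR u).

Lemma continuous_gamma_kernel a l : continuous (gamma_kernel a l).
Proof.
move=> x; apply: differentiable_continuous; apply/derivable1_diffP.
exact: ex_derive.
Qed.

(** For u <= 0 the factor e^(-e^u) is dropped. For u > 0 the tangent line of
    the exponential at ln (a + 1), namely e^u >= (a + 1)(1 + u - ln (a + 1)),
    leaves a decay of e^(-u). Both majorants are multiples of densities of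
    exponential laws, hence integrable. *)
Lemma gamma_kernel_bound a u : 0 < a ->
  gamma_kernel a 1 u <= a^-1 * exponential_pdf a (- u) +
    expR ((a + 1) * ln (a + 1)) * exponential_pdf 1 u.
Proof.
move=> a0; rewrite /gamma_kernel mul1r.
have a10 : 0 < a + 1 by rewrite addr_gt0.
have [u0|u0] := leP u 0.
  apply: (@le_trans _ _ (a^-1 * exponential_pdf a (- u))); last first.
    by rewrite lerDl mulr_ge0 ?expR_ge0 ?exponential_pdf_ge0 ?ler01.
  rewrite exponential_pdfE ?oppr_ge0// mulrA mulVf ?gt_eqF// mul1r ler_expR.
  by rewrite mulrNN gerBl expR_ge0.
apply: (@le_trans _ _ (expR ((a + 1) * ln (a + 1)) * exponential_pdf 1 u));
  last first.
  by rewrite lerDr mulr_ge0 ?invr_ge0 ?exponential_pdf_ge0 ?ltW.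
rewrite (exponential_pdfE _ (ltW u0)).
rewrite mul1r -expRD ler_expR.
have : (a + 1) * (1 + (u - ln (a + 1))) <= expR u.
  have -> : expR u = (a + 1) * expR (u - ln (a + 1)).
    by rewrite -{1}[a + 1]lnK ?posrE// -expRD subrKC.
  by rewrite ler_pM2l// expR_ge1Dx.
lra.
Qed.

Lemma integrable_gamma_kernel1 a : 0 < a ->
  mu1.-integrable setT (EFin \o gamma_kernel a 1).
Proof.
move=> a0.
apply: (@rintegrable_le _ (measurableTypeR R) R mu1 _
  (fun u => a^-1 * exponential_pdf a (- u) +
    expR ((a + 1) * ln (a + 1)) * exponential_pdf 1 u)).
- by apply: continuous_measurable_fun; exact: continuous_gamma_kernel.
- by move=> x; rewrite ger0_norm ?expR_ge0// gamma_kernel_bound.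
- apply: rintegrableD.
  + apply/rintegrableZ/(integrable_reflect (f := exponential_pdf a)).
    exact: integrable_exponential_pdf.
  + by apply: rintegrableZ; exact: integrable_exponential_pdf.
Qed.

Definition Gamma (a : R) : R := \int[mu1]_u gamma_kernel a 1 u.

Lemma gamma_kernel_shift a l u : 0 < l ->
  gamma_kernel a 1 (u + ln l) = l `^ a * gamma_kernel a l u.
Proof.
move=> l0; rewrite /gamma_kernel mul1r (expRD u) lnK ?posrE// /powR gt_eqF// -expRD.
by congr expR; ring.
Qed.

Lemma integral_gamma_kernel1_shift a c :
  (\int[mu1]_u (gamma_kernel a 1 (u + c))%:E =
    \int[mu1]_u (gamma_kernel a 1 u)%:E)%E.
Proof.
have d (x : R) : is_derive x (1 : R) (fun u : R => u + c) 1.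
  by apply: is_derive_eq; rewrite addr0.
have dE : derive1 (fun u : R => u + c) = cst 1.
  by apply/funext => x; rewrite derive1E; apply: derive_val.
rewrite [RHS](@increasing_ge0_integration_by_substitutionT R (fun u => u + c)).
- by rewrite dE; apply: eq_integral => x _; rewrite fctE /= mulr1.
- by move=> x y xy; rewrite /= ltrD2r.
- by rewrite dE => x; exact: cvg_cst.
- by rewrite dE; exact: is_cvg_cst.
- by rewrite dE; exact: is_cvg_cst.
- by move=> x; exact: ex_derive.
- apply/cvgNy_compNP; rewrite /comp.
  have -> : (fun x : R => - x + c) = (fun x => - (x - c)).
    by apply/funext => x; rewrite opprB addrC.
  by apply/cvgNrNy; exact: cvg_addrr.
- exact: cvg_addrr.
- exact: continuous_gamma_kernel.
- by move=> x; exact: expR_ge0.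
Qed.

Lemma integrable_gamma_kernel a l : 0 < a -> 0 < l ->
  mu1.-integrable setT (EFin \o gamma_kernel a l).
Proof.
move=> a0 l0.
have -> : gamma_kernel a l = fun u => l `^ (- a) * gamma_kernel a 1 (u + ln l).
  by apply/funext => u; rewrite gamma_kernel_shift// mulrA powRN mulVf ?mul1r//
    gt_eqF// powR_gt0.
apply/rintegrableZ/integrableP; split.
  apply/measurable_EFinP; apply: continuous_measurable_fun => x.
  apply: (@continuous_comp _ _ _ (fun u => u + ln l) (gamma_kernel a 1)).
    by apply: cvgD; [exact: cvg_id|exact: cvg_cst].
  exact: continuous_gamma_kernel.
under eq_integral do rewrite /= ger0_norm ?expR_ge0//.
rewrite integral_gamma_kernel1_shift.
have /integrableP[_] := integrable_gamma_kernel1 a0.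
by under eq_integral do rewrite /= ger0_norm ?expR_ge0//.
Qed.

Lemma Rintegral_gamma_kernel a l : 0 < a -> 0 < l ->
  \int[mu1]_u gamma_kernel a l u = Gamma a * l `^ (- a).
Proof.
move=> a0 l0; have la0 : l `^ a != 0 by rewrite gt_eqF ?powR_gt0.
suff e : (\int[mu1]_u gamma_kernel a l u) * l `^ a = Gamma a
  by rewrite powRN -e mulfK.
rewrite -RintegralZr; [|by []|exact: integrable_gamma_kernel].
under eq_Rintegral do rewrite mulrC -gamma_kernel_shift//.
by rewrite /Gamma /Rintegral integral_gamma_kernel1_shift.
Qed.

End gamma_integral.
(** A positive integral is at least its part over one interval of length 1; in
    the logarithmic coordinate u = ln t such an interval is a range of times
    [tau, e tau]. *)
Lemma Rintegral_ge_unit_itv {R : realType} (f : R -> R) (l k : R) :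
  (@lebesgue_measure R).-integrable setT (EFin \o f) -> (forall u, 0 <= f u) ->
  (forall u, l <= u <= l + 1 -> k <= f u) -> 0 <= k ->
  k <= \int[lebesgue_measure]_u f u.
Proof.
move=> intf f0 kf k0.
rewrite -lee_fin -(rintegrable_EFinE intf).
apply: (@le_trans _ _ (\int[lebesgue_measure]_(u in
  `[l, (l + 1)%R]%classic) (f u)%:E)%E); last first.
  apply: ge0_subset_integral => //; first by case/integrableP: intf.
  by move=> u _; rewrite lee_fin.
apply: (@le_trans _ _ (\int[lebesgue_measure]_(u in
  `[l, (l + 1)%R]%classic) k%:E)%E).
  rewrite integral_cst//= lebesgue_measure_itv/= lte_fin ltrDl ltr01 -EFinD.
  by rewrite addrAC subrr add0r mule1.
apply: ge0_le_integral => //.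
by apply: measurable_funTS; case/integrableP: intf.
Qed.

(** * Gaussian averages of the Bessel kernel *)

(** Algebra behind two evaluations of gauss_fourier at frequency 2 p, with p
    standing for pi: at b = p^2 / a, where the transform is proportional to
    the Gaussian of exponent a, and at b + 4 p^2 e, the exponent reached after
    running the heat flow for time e. *)
Section scalar_identities.
Context {R : realType}.
Implicit Types a p e d : R.

Let pos1 a e : 0 < a -> 0 < e -> 0 < 1 + 4 * a * e.
Proof. by move=> a0 e0; rewrite addr_gt0// !mulr_gt0. Qed.

Let pos2 a p e : 0 < a -> 0 < p -> 0 < e -> 0 < p ^+ 2 + 4 * p ^+ 2 * e * a.
Proof. by move=> a0 p0 e0; rewrite addr_gt0 ?exprn_gt0// !mulr_gt0// exprn_gt0. Qed.

Lemma heat_normalisation a p e : 0 < a -> 0 < p -> 0 < e ->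
  p / (p ^+ 2 / a + 4 * p ^+ 2 * e) = a / p / (1 + 4 * a * e).
Proof.
move=> a0 p0 e0; field; have := pos1 a0 e0; have := pos2 a0 p0 e0.
by move=> *; rewrite !gt_eqF.
Qed.

Lemma heat_exponent a p e d : 0 < a -> 0 < p -> 0 < e ->
  (2 * p) ^+ 2 * d / (4 * (p ^+ 2 / a + 4 * p ^+ 2 * e)) =
  a / (1 + 4 * a * e) * d.
Proof.
move=> a0 p0 e0; field; have := pos1 a0 e0; have := pos2 a0 p0 e0.
by move=> *; rewrite !gt_eqF.
Qed.

Lemma gauss_normalisation a p : 0 < a -> 0 < p -> a / p = p / (p ^+ 2 / a).
Proof. by move=> a0 p0; field; rewrite !gt_eqF. Qed.

Lemma gauss_exponent a p d : 0 < a -> 0 < p ->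
  a * d = (2 * p) ^+ 2 * d / (4 * (p ^+ 2 / a)).
Proof. by move=> a0 p0; field; rewrite !gt_eqF. Qed.

End scalar_identities.

Section bessel_kernel.
Local Open Scope complex_scope.
Context {R : realType} {n : nat} {s : R} {G : Rn R n -> R}.
Hypotheses (s0 : 0 < s) (besselG : is_bessel_kernel s G).
Local Notation mu1 := (@lebesgue_measure R).
Local Notation lebn := (leb R n).

Let G0 : forall x, 0 <= G x. Proof. by case: besselG. Qed.
Let intG : lebn.-integrable setT (EFin \o G). Proof. by case: besselG. Qed.
Let s20 : 0 < s / 2. Proof. by rewrite divr_gt0. Qed.

Definition symbol (xi : Rn R n) : R := 1 + 4 * pi ^+ 2 * dot xi xi.

Let symbol_ge1 xi : 1 <= symbol xi.
Proof. by rewrite /symbol lerDl mulr_ge0 ?dot_ge0// mulr_ge0// sqr_ge0. Qed.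

Let symbol_gt0 xi : 0 < symbol xi. Proof. exact: lt_le_trans (symbol_ge1 xi). Qed.

Lemma bessel_cos xi :
  \int[lebn]_y (G y * cos (2 * pi * dot y xi)) = symbol xi `^ (- (s / 2)).
Proof.
have [_ _ /(_ xi)[+ _]] := besselG.
rewrite /symbol => <-; apply: eq_Rintegral => y _.
by rewrite /= mul0r subr0 cosN.
Qed.

Lemma bessel_sin xi : \int[lebn]_y (G y * sin (2 * pi * dot y xi)) = 0.
Proof.
have [_ _ /(_ xi)[_ e]] := besselG.
apply/eqP; rewrite -oppr_eq0 -mulN1r -RintegralZl//; last first.
  apply: (rintegrableM_bounded (k := 1) intG).
    apply: measurableT_comp; first exact: measurable_sin.
    by apply: measurable_funM => //; exact: measurable_fun_dot.
  by move=> y; exact: norm_sin_le1.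
apply/eqP; rewrite -[RHS]e; apply: eq_Rintegral => y _.
by rewrite /= mul0r addr0 sinN mulrN mulN1r.
Qed.

(** The translation by x is expanded with the addition formula; the sine part
    vanishes because the transform of G is real. *)
Lemma bessel_cos_shift x xi :
  \int[lebn]_y (G y * cos (2 * pi * dot (vadd x y) xi)) =
  cos (2 * pi * dot x xi) * symbol xi `^ (- (s / 2)).
Proof.
have mc k : measurable_fun setT (fun y : Rn R n => k * dot y xi).
  by apply: measurable_funM => //; exact: measurable_fun_dot.
have ic : lebn.-integrable setT (EFin \o (fun y => G y * cos (2 * pi * dot y xi))).
  apply: (rintegrableM_bounded (k := 1) intG);
    last by move=> y; exact: norm_cos_le1.
  exact: measurableT_comp measurable_cos (mc _).
have is_ : lebn.-integrable setT (EFin \o (fun y => G y * sin (2 * pi * dot y xi))).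
  apply: (rintegrableM_bounded (k := 1) intG);
    last by move=> y; exact: norm_sin_le1.
  exact: measurableT_comp measurable_sin (mc _).
set t := 2 * pi * dot x xi.
transitivity (\int[lebn]_y (cos t * (G y * cos (2 * pi * dot y xi)) -
    sin t * (G y * sin (2 * pi * dot y xi)))).
  apply: eq_Rintegral => y _; rewrite dot_vaddl mulrDr cosD -/t; ring.
rewrite RintegralB//; [|exact: rintegrableZ|exact: rintegrableZ].
by rewrite !RintegralZl// bessel_sin bessel_cos mulr0 subr0.
Qed.

(** The Gaussian e^(-a |x|^2) after the heat flow has run for time e^u, at the
    point x. *)
Definition heat_factor (a : R) (x : Rn R n) (u : R) : R :=
  Num.sqrt (1 + 4 * a * expR u) ^- n *
  expR (- (a / (1 + 4 * a * expR u) * dot x x)).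

(** The operator (1 - Delta)^(-s/2) is a Gamma-weighted superposition of the
    damped heat flows e^(-t) e^(t Delta); this is the weight times the flow
    applied to a Gaussian, at t = e^u. *)
Definition heat_mix (a : R) (x : Rn R n) (u : R) : R :=
  gamma_kernel (s / 2) 1 u * heat_factor a x u.

Let measurable_heat_factor a x : 0 < a -> measurable_fun setT (heat_factor a x).
Proof.
move=> a0; have ge0 u : 0 <= 1 + 4 * a * expR u.
  by rewrite addr_ge0// !mulr_ge0 ?expR_ge0// ltW.
have -> : heat_factor a x = fun u => (1 + 4 * a * expR u) `^ (- (2^-1 * n%:R)) *
     expR (- (a * (1 + 4 * a * expR u) `^ (-1) * dot x x)).
  apply/funext => u; rewrite powR_inv1// powRN powRrM powR12_sqrt//.
  by rewrite powR_mulrn ?sqrtr_ge0.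
have m : measurable_fun setT (fun u : R => 1 + 4 * a * expR u).
  by apply: measurable_funD => //; exact: measurable_funM.
apply: measurable_funM; first exact: measurableT_comp (measurable_powR _) m.
apply: measurableT_comp => //; apply: measurableT_comp => //.
apply: measurable_funM => //; apply: measurable_funM => //.
exact: measurableT_comp (measurable_powR _) m.
Qed.

Lemma integrable_heat_mix a x : 0 < a ->
  mu1.-integrable setT (EFin \o heat_mix a x).
Proof.
move=> a0; apply: (rintegrableM_bounded (k := 1) (integrable_gamma_kernel1 s20)).
  exact: measurable_heat_factor.
rewrite /heat_factor => u; have g1 : 1 <= 1 + 4 * a * expR u.
  by rewrite lerDl !mulr_ge0 ?expR_ge0// ltW.
have g0 : 0 <= 1 + 4 * a * expR u := le_trans ler01 g1.
rewrite ger0_norm ?mulr_ge0 ?expR_ge0 ?invr_ge0 ?exprn_ge0 ?sqrtr_ge0//.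
rewrite -[leRHS]mulr1 ler_pM ?expR_ge0 ?invr_ge0 ?exprn_ge0 ?sqrtr_ge0//.
  have s1 : 1 <= Num.sqrt (1 + 4 * a * expR u) by rewrite -{1}sqrtr1 ler_wsqrtr.
  by rewrite invf_le1 ?exprn_ege1// exprn_gt0// (lt_le_trans ltr01).
by rewrite -[leRHS]expR0 ler_expR oppr_le0 mulr_ge0 ?dot_ge0// divr_ge0// ltW.
Qed.

(** An unnormalised average of G at scale a^(-1/2) around -x. The Fourier
    transform determines G only almost everywhere, so bounds are sought for
    such averages rather than for G. *)
Definition gauss_mean (a : R) (x : Rn R n) : R :=
  \int[lebn]_y (G y * gauss a (vadd x y)).

(** The Gaussian of exponent a is the Fourier transform of the one of exponent
    pi^2 / a, up to normalisation. After exchanging the integrals, the inner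
    one is the transform of G, at xi and translated by x. *)
Lemma gauss_mean_fourier a x : 0 < a ->
  Num.sqrt (a / pi) ^+ n * gauss_mean a x =
  \int[lebn]_xi (gauss (pi ^+ 2 / a) xi *
     (cos (2 * pi * dot x xi) * symbol xi `^ (- (s / 2)))).
Proof.
move=> a0; set b := pi ^+ 2 / a.
have p0 : 0 < pi :> R := pi_gt0 R.
have pn0 : pi != 0 :> R by rewrite gt_eqF.
have an0 : a != 0 by rewrite gt_eqF.
have b0 : 0 < b by rewrite divr_gt0 ?exprn_gt0.
pose F (y xi : Rn R n) := G y * gauss b xi * cos (2 * pi * dot (vadd x y) xi).
transitivity (\int[lebn]_y \int[lebn]_xi F y xi).
  rewrite /gauss_mean -RintegralZl//; last first.
    apply: (rintegrableM_bounded (k := 1) intG).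
      apply: measurableT_comp; first exact: measurable_gauss.
      by apply: measurable_vadd.
    by move=> y; rewrite ger0_norm ?gauss_ge0// gauss_le1// ltW.
  apply: eq_Rintegral => y _; rewrite /F.
  under eq_Rintegral do rewrite -mulrA.
  rewrite RintegralZl//; last first.
    by apply: integrable_gauss_trig => //;
      [exact: measurable_cos|exact: norm_cos_le1].
  rewrite gauss_fourier// mulrCA; congr (_ * (Num.sqrt _ ^+ n * expR _)).
    exact: gauss_normalisation.
  by rewrite -gauss_exponent.
rewrite (Rintegral_swap intG (integrable_gauss n b0)).
- apply: eq_Rintegral => xi _.
  rewrite -bessel_cos_shift -RintegralZl//.
    by apply: eq_Rintegral => y _; rewrite /F mulrCA mulrA.
  apply: (rintegrableM_bounded (k := 1) intG);
    last by move=> y; exact: norm_cos_le1.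
  apply: measurableT_comp; first exact: measurable_cos.
  apply: measurable_funM => //; apply: measurable_fun_dot => //.
  exact: measurable_vadd.
- have mG := rintegrable_measurable intG.
  apply: measurable_funM; last first.
    apply: measurableT_comp; first exact: measurable_cos.
    apply: measurable_funM => //; apply: measurable_fun_dot => //.
    by apply: measurable_vadd.
  apply: measurable_funM; first exact: measurableT_comp mG _.
  by apply: measurableT_comp => //; exact: measurable_gauss.
- move=> y xi; rewrite /F normrM ger0_norm ?mulr_ge0 ?gauss_ge0//.
  by rewrite ler_piMr ?norm_cos_le1// mulr_ge0 ?gauss_ge0.
Qed.

(** In gauss_mean_fourier, the power symbol^(-s/2) is replaced by its Gamma
    integral. Its exponential e^(-t symbol) merges with the Gaussian in xi,
    and after exchanging the integrals gauss_fourier evaluates the inner one.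
    What remains has no oscillation: it is a positive integral, which can be
    bounded below termwise. *)
Lemma gauss_mean_heat a x : 0 < a ->
  Gamma (s / 2) * gauss_mean a x = \int[mu1]_u heat_mix a x u.
Proof.
move=> a0; set b := pi ^+ 2 / a.
have p0 : 0 < pi :> R := pi_gt0 R.
have pn0 : pi != 0 :> R by rewrite gt_eqF.
have an0 : a != 0 by rewrite gt_eqF.
have b0 : 0 < b by rewrite divr_gt0 ?exprn_gt0.
have k0 : Num.sqrt (a / pi) ^+ n != 0.
  by rewrite expf_neq0// gt_eqF// sqrtr_gt0 divr_gt0.
apply: (mulfI k0); rewrite mulrCA gauss_mean_fourier// -/b.
pose F (xi : Rn R n) (u : R) := gauss b xi * cos (2 * pi * dot x xi) *
  gamma_kernel (s / 2) (symbol xi) u.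
have FE xi u : F xi u = gamma_kernel (s / 2) 1 u *
    (gauss (b + 4 * pi ^+ 2 * expR u) xi * cos (2 * pi * dot x xi)).
  rewrite /F mulrAC /gamma_kernel /gauss mulrA -!expRD; congr (expR _ * _).
  by rewrite /symbol; ring.
transitivity (\int[lebn]_xi \int[mu1]_u F xi u).
  rewrite -RintegralZl//; last first.
    apply: (rintegrableM_bounded (k := 1) (integrable_gauss n b0)).
      apply: measurable_funM.
        apply: measurableT_comp; first exact: measurable_cos.
        by apply: measurable_funM => //; exact: measurable_fun_dot.
      apply: (measurableT_comp (measurable_powR _)).
      apply: measurable_funD => //; apply: measurable_funM => //.
      exact: measurable_fun_dot.
    move=> xi; rewrite normrM -[leRHS]mulr1 ler_pM ?norm_cos_le1//.
    rewrite ger0_norm ?powR_ge0// powRN invf_le1 ?powR_gt0//.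
    by rewrite -[leLHS](powRr0 (symbol xi)) ler_powR ?symbol_ge1// ltW.
  apply: eq_Rintegral => xi _; rewrite /F RintegralZl//;
    last exact: integrable_gamma_kernel.
  by rewrite Rintegral_gamma_kernel//; ring.
rewrite (Rintegral_swap (integrable_gauss n b0) (integrable_gamma_kernel1 s20)).
- rewrite -RintegralZl//; last exact: integrable_heat_mix.
  apply: eq_Rintegral => u _.
  under eq_Rintegral do rewrite FE.
  have bu0 : 0 < b + 4 * pi ^+ 2 * expR u.
    by rewrite addr_gt0// !mulr_gt0 ?expR_gt0 ?exprn_gt0.
  rewrite RintegralZl//; last first.
    by apply: integrable_gauss_trig => //;
      [exact: measurable_cos|exact: norm_cos_le1].
  rewrite gauss_fourier// /heat_mix /heat_factor [RHS]mulrCA; congr (_ * _).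
  rewrite [RHS]mulrA; congr (_ * expR _).
    rewrite -exprVn -exprMn -sqrtrV; last by rewrite addr_ge0//
      !mulr_ge0 ?ltW ?expR_gt0.
    rewrite -sqrtrM; last by rewrite divr_ge0 ?ltW.
    congr (Num.sqrt _ ^+ n).
    by rewrite heat_normalisation// expR_gt0.
  by rewrite heat_exponent// expR_gt0.
- apply: measurable_funM.
    apply: measurable_funM.
      by apply: measurableT_comp; first exact: measurable_gauss.
    apply: measurableT_comp; first exact: measurable_cos.
    by apply: measurable_funM => //; exact: measurable_fun_dot.
  apply: measurableT_comp => //; apply: measurable_funB.
    exact: measurable_funM.
  apply: measurable_funM; last exact: measurableT_comp.
  apply: measurable_funD => //; apply: measurable_funM => //.
  exact: measurable_fun_dot.
- move=> xi u; rewrite /F normrM; apply: ler_pM => //.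
    by rewrite normrM ger0_norm ?gauss_ge0// ler_piMr ?norm_cos_le1 ?gauss_ge0.
  rewrite ger0_norm ?expR_ge0//.
  by rewrite ler_expR lerD2l lerN2 ler_wpM2r ?expR_ge0// symbol_ge1.
Qed.

(** * Lower bounds for the Bessel kernel near the origin *)

Lemma integrable_gauss_shift a x : 0 < a ->
  lebn.-integrable setT (EFin \o (fun y => G y * gauss a (vadd x y))).
Proof.
move=> a0; apply: (rintegrableM_bounded (k := 1) intG).
  apply: measurableT_comp; first exact: measurable_gauss.
  exact: measurable_vadd.
by move=> y; rewrite ger0_norm ?gauss_ge0// gauss_le1// ltW.
Qed.

Lemma Gamma_gt0 (a : R) : 0 < a -> 0 < Gamma a.
Proof.
move=> a0; apply: (@lt_le_trans _ _ (expR (- expR 1))); first exact: expR_gt0.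
apply: (@Rintegral_ge_unit_itv _ _ 0) => [|u|u|]; last exact: expR_ge0.
- exact: integrable_gamma_kernel1.
- exact: expR_ge0.
- rewrite add0r => /andP[u0 u1]; rewrite ler_expR mul1r lerBrDr addrC.
  by rewrite (@le_trans _ _ 0) ?mulr_ge0 ?(ltW a0)// subr_le0 ler_expR.
Qed.

Lemma heat_mix_ge0 a x u : 0 < a -> 0 <= heat_mix a x u.
Proof.
by move=> a0; rewrite !mulr_ge0 ?expR_ge0// invr_ge0 exprn_ge0// sqrtr_ge0.
Qed.

Definition heat_const : R :=
  expR (- expR 1) * (Num.sqrt (1 + 4 * expR 1) ^- n * expR (- (n%:R / 4))).

Lemma heat_const_gt0 : 0 < heat_const.
Proof.
by rewrite /heat_const !mulr_gt0 ?expR_gt0// invr_gt0 exprn_gt0// sqrtr_gt0.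
Qed.

(** For heat times t = e^u between tau and e tau, the weight is at least
    e^(-e) tau^(s/2), the normalisation satisfies 1 + 4 a t <= (1 + 4 e) a tau
    because a tau >= 1, and the exponent a |x|^2 / (1 + 4 a t) is at most n
    tau / (4 t) <= n / 4. *)
Lemma heat_mix_lower a tau x u : 0 < tau <= 1 -> 1 <= a * tau ->
  dot x x <= n%:R * tau -> ln tau <= u <= ln tau + 1 ->
  heat_const * (tau `^ (s / 2) * Num.sqrt (a * tau) ^- n) <= heat_mix a x u.
Proof.
move=> /andP[t0 t1] at1 xt /andP[lu ul].
have at0 : 0 < a * tau := lt_le_trans ltr01 at1.
have a0 : 0 < a by rewrite -(pmulr_lgt0 _ t0).
have Eu : tau <= expR u by rewrite -[tau]lnK ?posrE// ler_expR.
have uE : expR u <= expR 1 * tau.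
  by rewrite -[tau in leRHS]lnK ?posrE// -expRD ler_expR addrC.
have e1 : 0 < expR 1 :> R := expR_gt0 1.
have E0 : 0 < expR u := expR_gt0 u.
have c0 : 0 < 1 + 4 * a * expR u by rewrite addr_gt0// !mulr_gt0.
have h1 : expR (- expR 1) * tau `^ (s / 2) <= gamma_kernel (s / 2) 1 u.
  rewrite /gamma_kernel /powR gt_eqF// -expRD ler_expR addrC mul1r lerB//.
    by rewrite ler_wpM2l// ltW.
  by rewrite (le_trans uE)// ler_piMr// ltW.
have h2 : Num.sqrt (1 + 4 * expR 1) ^- n * Num.sqrt (a * tau) ^- n <=
    Num.sqrt (1 + 4 * a * expR u) ^- n.
  have e41 : 0 < 1 + 4 * expR 1 :> R by rewrite addr_gt0// mulr_gt0.
  rewrite -invfM -exprMn -sqrtrM ?(ltW e41)//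
    lef_pV2 ?posrE ?exprn_gt0 ?sqrtr_gt0//; last first.
    exact: mulr_gt0.
  have le : 1 + 4 * a * expR u <= (1 + 4 * expR 1) * (a * tau).
    have : a * expR u <= a * (expR 1 * tau) by rewrite ler_pM2l.
    by move=> ?; lra.
  by apply: lerXn2r; rewrite ?nnegrE ?sqrtr_ge0// ler_wsqrtr.
have h3 : expR (- (n%:R / 4)) <= expR (- (a / (1 + 4 * a * expR u) * dot x x)).
  rewrite ler_expR lerN2 mulrAC ler_pdivrMr//.
  have n0 : 0 <= n%:R :> R by [].
  have : a * dot x x <= a * (n%:R * expR u).
    by rewrite ler_pM2l// (le_trans xt)// ler_wpM2l.
  by move=> h; apply: (le_trans h); nra.
rewrite /heat_mix /heat_factor /heat_const.
set A := expR (- expR 1) in h1 *; set B := _ ^- n in h2 *.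
set D := expR (- (n%:R / 4)) in h3 *; set T := tau `^ _ in h1 *.
set Q := Num.sqrt (a * tau) ^- n in h2 *.
have -> : A * (B * D) * (T * Q) = A * T * (B * Q * D) by ring.
have [A0 T0 D0] : [/\ 0 <= A, 0 <= T & 0 <= D].
  by split; [exact: expR_ge0|exact: powR_ge0|exact: expR_ge0].
have B0 : 0 <= B by rewrite invr_ge0 exprn_ge0// sqrtr_ge0.
have Q0 : 0 <= Q by rewrite invr_ge0 exprn_ge0// sqrtr_ge0.
by rewrite ler_pM ?ler_pM ?mulr_ge0.
Qed.

(** All terms of gauss_mean_heat are positive, so it is enough to keep the
    heat times between tau and e tau. *)
Lemma gauss_mean_lower : exists2 c, 0 < c &
  forall a tau x, 0 < tau <= 1 -> 1 <= a * tau -> dot x x <= n%:R * tau ->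
  c * (tau `^ (s / 2) * Num.sqrt (a * tau) ^- n) <= gauss_mean a x.
Proof.
exists (heat_const / Gamma (s / 2)); first by rewrite divr_gt0 ?heat_const_gt0
  ?Gamma_gt0.
move=> a tau x /[dup] /andP[t0 t1] t01 at1 xt.
have a0 : 0 < a by rewrite -(pmulr_lgt0 _ t0) (lt_le_trans ltr01).
rewrite mulrAC ler_pdivrMr ?Gamma_gt0// [leRHS]mulrC gauss_mean_heat//.
apply: (@Rintegral_ge_unit_itv _ _ (ln tau)).
- exact: integrable_heat_mix.
- by move=> u; exact: heat_mix_ge0.
- by move=> u; exact: heat_mix_lower.
- by rewrite !mulr_ge0 ?powR_ge0 ?(ltW heat_const_gt0)// invr_ge0 exprn_ge0//
  sqrtr_ge0.
Qed.

(** Termwise in gauss_mean_heat at x = 0, as 1 + 8 a t <= 2 (1 + 4 a t). *)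
Lemma gauss_mean_doubling a : 0 < a ->
  Num.sqrt 2 ^- n * gauss_mean a vzero <= gauss_mean (2 * a) vzero.
Proof.
move=> a0; have a20 : 0 < 2 * a by rewrite mulr_gt0.
rewrite -(ler_pM2l (Gamma_gt0 s20)) mulrCA !gauss_mean_heat//.
rewrite -RintegralZl//; last exact: integrable_heat_mix.
apply: le_Rintegral => //.
- exact/rintegrableZ/integrable_heat_mix.
- exact: integrable_heat_mix.
- move=> u _; rewrite /heat_mix /heat_factor dot0v !mulr0 oppr0 expR0 !mulr1.
  rewrite mulrCA ler_wpM2l ?expR_ge0//.
  have h (b : R) : 0 < b -> 0 < 1 + 4 * b * expR u.
    by move=> b0; rewrite addr_gt0// !mulr_gt0// expR_gt0.
  rewrite -invfM -exprMn -sqrtrM// lef_pV2 ?posrE ?exprn_gt0 ?sqrtr_gt0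
    ?mulr_gt0 ?h//.
  rewrite lerXn2r ?nnegrE ?sqrtr_ge0// ler_wsqrtr//.
  by have := expR_gt0 u; nra.
Qed.

(** Gaussian averages at the origin see all of G, so a tail has to be removed
    without an upper bound on G. Comparing two widths does this: e^(-2a|y|^2)
    <= 1 on the ball, while outside it e^(-2a|y|^2) <= e^(-a rho^2)
    e^(-a|y|^2). Hence the mass of the ball is at least gauss_mean (2a) -
    e^(-a rho^2) gauss_mean a, which by the doubling bound is at least
    (2^(-n/2) - e^(-n)) gauss_mean a once a rho^2 = n. *)
Lemma bessel_ball_mass : (0 < n)%N -> exists2 c, 0 < c &
  forall rho, 0 < rho <= 1 ->
  c * rho `^ s <= \int[lebn]_y (G y * \1_[set y | supn y < rho] y).
Proof.
move=> n0; have [c c0 hc] := gauss_mean_lower.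
have nR : 0 < n%:R :> R by rewrite ltr0n.
have gap : 0 < Num.sqrt 2 ^- n - expR (- n%:R) :> R.
  have s2 : Num.sqrt 2 < expR 1 :> R.
    apply: (@lt_le_trans _ _ 2); last by apply: le_trans (expR_ge1Dx 1).
    by rewrite -(@ltr_pXn2r _ 2)// ?nnegrE ?sqrtr_ge0// sqr_sqrtr//; lra.
  rewrite subr_gt0 expRN -[n%:R]mulr1 expRM_natl.
  rewrite ltf_pV2 ?posrE ?exprn_gt0 ?expR_gt0 ?sqrtr_gt0//.
  by rewrite ltr_pXn2r ?nnegrE ?sqrtr_ge0 ?expR_ge0.
exists ((Num.sqrt 2 ^- n - expR (- n%:R)) * (c * (n%:R `^ (- (s / 2))))).
  by rewrite !mulr_gt0// powR_gt0.
move=> rho /andP[r0 r1].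
(* The choice a rho^2 = n makes e^(-a rho^2) smaller than the doubling
   constant 2^(-n/2); tau = 1 / a is the matching heat time. *)
pose a := n%:R / rho ^+ 2; pose tau := rho ^+ 2 / n%:R.
have a0 : 0 < a by rewrite divr_gt0// exprn_gt0.
have t0 : 0 < tau by rewrite divr_gt0// exprn_gt0.
have at1 : a * tau = 1 by rewrite /a /tau; field; rewrite !gt_eqF.
have t1 : tau <= 1.
  by rewrite /tau ler_pdivrMr// mul1r (@le_trans _ _ 1) ?ler1n// exprn_ile1// ltW.
have := hc a tau vzero; rewrite t0 t1 at1 lexx dot0v sqrtr1 expr1n invr1 mulr1.
move=> /(_ isT isT (mulr_ge0 (ltW nR) (ltW t0))) Plow.
have tauE : tau `^ (s / 2) = n%:R `^ (- (s / 2)) * rho `^ s.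
  rewrite /tau -powR_mulrn ?(ltW r0)// -(powR_inv1 (ltW nR)).
  rewrite powRM ?powR_ge0// -!powRrM mulrC mulN1r; congr (_ * _ `^ _).
  by rewrite mulrCA mulfV ?mulr1.
have P0 : 0 <= gauss_mean a vzero.
  by apply: Rintegral_ge0 => y _; rewrite mulr_ge0 ?gauss_ge0.
rewrite -mulrA -[c * _ * _]mulrA -tauE.
apply: (@le_trans _ _ ((Num.sqrt 2 ^- n - expR (- n%:R)) * gauss_mean a vzero)).
  by rewrite ler_pM2l.
rewrite mulrBl lerBlDr (le_trans (gauss_mean_doubling a0))//.
have intind : lebn.-integrable setT (EFin \o
  (fun y => G y * \1_[set y | supn y < rho] y)).
  apply: (rintegrableM_bounded (k := 1) intG).
    by apply: measurable_indic; exact: measurable_supn_lt.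
  by move=> y; rewrite indicE; case: (_ \in _); rewrite ?normr1 ?normr0.
have intg := integrable_gauss_shift vzero a0.
rewrite -RintegralZl// -RintegralD//; last exact: rintegrableZ.
apply: le_Rintegral => //.
- by apply: integrable_gauss_shift; rewrite mulr_gt0.
- by apply: rintegrableD => //; exact: rintegrableZ.
- move=> y _; rewrite !vadd0 (mulrCA (expR _)) -mulrDr ler_wpM2l// indicE.
  have [yr|ry] := ltP (supn y) rho.
    rewrite mem_set//; apply: (@le_trans _ _ 1).
      by apply: gauss_le1; exact/ltW/mulr_gt0.
    by rewrite lerDl mulr_ge0 ?expR_ge0.
  rewrite memNset/=; last by apply/negP; rewrite -leNgt.
  rewrite add0r -expRD ler_expR.
  have : rho ^+ 2 <= dot y y.
    apply: (le_trans _ (sqr_supn_le_dot y)).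
    by apply: lerXn2r => //; rewrite nnegrE ?supn_ge0// ltW.
  rewrite -(ler_pM2l a0) {1}/a divfK ?gt_eqF ?exprn_gt0//.
  lra.
Qed.

End bessel_kernel.

(** * Lower bounds for Lorentz norms *)

Section lorentz_lower_bound.
Local Open Scope complex_scope.
Context {R : realType}.

(** The integral of a nonnegative function is a supremum over the simple
    functions below it, so monotonicity needs no measurability. This spares
    proving that a decreasing rearrangement is measurable. *)
Lemma ge0_le_integral_nonmeasurable d (T : measurableType d)
    (mu : {measure set T -> \bar R}) (D : set T) (f g : T -> \bar R) :
  (forall x, 0 <= f x)%E -> (forall x, D x -> 0 <= g x)%E ->
  (forall x, (f x <= (g \_ D) x)%E) ->
  (\int[mu]_x f x <= \int[mu]_(x in D) g x)%E.
Proof.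
move=> f0 g0 fg; rewrite ge0_integralTE// ge0_integralE//.
apply: le_ereal_sup => _ [h /= hf <-]; exists h => //= x.
exact: le_trans (hf x) (fg x).
Qed.

Lemma within_continuous_inv (A B : R) : 0 < A ->
  {within `[A, B], continuous (fun t : R => t^-1)}.
Proof.
move=> A0; apply: continuous_in_subspaceT => x.
rewrite inE/= in_itv/= => /andP[/(lt_le_trans A0) x0 _].
by apply: inv_continuous; rewrite gt_eqF.
Qed.

Lemma integral_inv (A B : R) : 0 < A -> A < B ->
  (\int[lebesgue_measure]_(t in `[A, B]) (t^-1)%:E = (ln B - ln A)%:E)%E.
Proof.
move=> A0 AB.
have pos x : A <= x -> 0 < x by exact: lt_le_trans.
have d (x : R) : A <= x -> is_derive x (1:R) (@ln R) x^-1.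
  by move=> /pos x0; exact: is_derive1_ln.
rewrite (@continuous_FTC2 _ (fun t : R => t^-1) (@ln R)) ?EFinB//.
- exact: within_continuous_inv.
- split.
  + move=> x; rewrite in_itv/= => /andP[/ltW Ax _].
    by have := d _ Ax => ?; exact: ex_derive.
  + exact/cvg_at_right_filter/continuous_ln.
  + exact/cvg_at_left_filter/continuous_ln/(lt_trans A0).
- move=> x; rewrite in_itv/= => /andP[/ltW Ax _].
  by have := d _ Ax => ?; rewrite derive1E derive_val.
Qed.

Lemma cabsE (z : R[i]) : cabs z = Num.sqrt (complex.Re z ^+ 2 + complex.Im z ^+ 2).
Proof. by case: z. Qed.

Lemma measurable_cabs d (T : measurableType d) (h : T -> R[i]) :
  measurable_fun setT (fun x => complex.Re (h x)) ->
  measurable_fun setT (fun x => complex.Im (h x)) ->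
  measurable_fun setT (fun x => cabs (h x)).
Proof.
move=> mRe mIm.
rewrite (_ : (fun _ => _) =
    fun x => Num.sqrt (complex.Re (h x) ^+ 2 + complex.Im (h x) ^+ 2)); last first.
  by apply/funext => x; exact: cabsE.
apply: (@measurableT_comp _ _ _ _ _ _ (@Num.sqrt R)).
  by apply: continuous_measurable_fun; exact: sqrt_continuous.
by apply: measurable_funD; exact: measurable_funX.
Qed.

Context {n : nat} (n0 : (0 < n)%N).
Variables (h : Rn R n -> R[i]) (r alpha c a b : R).
Hypotheses (r0 : 0 < r) (alpha0 : 0 < alpha) (c0 : 0 < c) (a0 : 0 < a)
  (ab : 8 * a < b).
Hypothesis mh : cmeasurable h.
Hypothesis ch : forall x, a <= supn x -> supn x < b ->
  c * supn x `^ (- (n%:R / r)) <= cabs (h x).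

Let nR0 : 0 < n%:R :> R. Proof. by rewrite ltr0n. Qed.

(** Let rho = t^(1/n), so that the ball of radius rho has measure 2^n t. On
    its part outside the ball of radius a, |h| is at least
    c rho^(-n/r) = c t^(-1/r). A level l below this value with d_h(l) <= t
    would give 2 t <= 2^n t <= t + (2a)^n < 2 t. *)
Lemma rearrangement_lower t : (2 * a) ^+ n < t -> t < b ^+ n ->
  ((c * t `^ (- r^-1))%:E <= rearrangement h t)%E.
Proof.
move=> at_ tb; apply: le_ereal_inf_tmp => _ [l [l0 dl] <-].
rewrite lee_fin leNgt; apply/negP => lc.
have a20 : 0 < 2 * a by rewrite mulr_gt0.
have t0 : 0 < t by rewrite (le_lt_trans _ at_)// exprn_ge0// ltW.
pose rho := t `^ n%:R^-1.
have rho0 : 0 < rho by exact: powR_gt0.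
have rhoE : rho ^+ n = t.
  by rewrite -powR_mulrn ?(ltW rho0)// -powRrM mulVf ?powRr1 ?gt_eqF// ltW.
have arho : 2 * a < rho.
  by rewrite -(@ltr_pXn2r _ n)// ?nnegrE ?(ltW a20) ?(ltW rho0)// rhoE.
have rhob : rho < b.
  have b0 : 0 < b by rewrite (lt_trans _ ab)// mulr_gt0.
  by rewrite -(@ltr_pXn2r _ n)// ?nnegrE ?(ltW b0) ?(ltW rho0)// rhoE.
have mballs := @measurable_supn_lt R n.
have mlev : measurable [set x | l < cabs (h x)].
  rewrite -[X in measurable X]setTI (_ : [set x | _] =
    (fun x => cabs (h x)) @^-1` `]l, +oo[%classic).
    by apply: (measurable_cabs mh.1 mh.2).
  by apply/seteqP; split=> x /=; rewrite in_itv/= andbT.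
have sub : [set x | supn x < rho] `<=` [set x | l < cabs (h x)] `|`
    [set x : Rn R n | supn x < a].
  move=> x /= xr; have [xa|ax] := ltP (supn x) a; [by right|left].
  have x0 : 0 < supn x := lt_le_trans a0 ax.
  rewrite (lt_le_trans lc)// (le_trans _ (ch ax (lt_trans xr rhob)))//.
  rewrite ler_pM2l// !powRN lef_pV2 ?posrE ?powR_gt0//.
  rewrite -[in leRHS]rhoE -powR_mulrn ?(ltW rho0)// -powRrM.
  by rewrite ge0_ler_powR ?nnegrE ?(ltW x0) ?(ltW xr) ?(ltW rho0)// divr_ge0// ltW.
have le1 : (leb R n [set x | (supn x < rho)%R] <=
    leb R n [set x | (l < cabs (h x))%R] + leb R n [set x | (supn x < a)%R])%E.
  apply: le_trans (measureU2 _ mlev (mballs _)).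
  by apply: le_measure => //; rewrite inE//; exact: measurableU.
move: le1; rewrite !leb_supn_lt// => /le_trans/(_ (leeD2r _ dl)).
rewrite -EFinD lee_fin exprMn rhoE => le2.
have : 2 * t <= 2 ^+ n * t by rewrite ler_pM2r// -{1}[2]expr1 ler_weXn2l// ler1n.
lra.
Qed.

(** The integrand (t^(1/r) h^*(t))^alpha / t is at least c^alpha / t on the
    range of rearrangement_lower; integrating 1 / t produces the logarithm.
    The interval [(4a)^n, (b/2)^n] lies strictly inside that range. *)
Lemma lorentz_norm_lower :
  ((c * (n%:R * (ln (b / 2) - ln (4 * a))) `^ alpha^-1)%:E <=
   lorentz_norm r alpha%:E h)%E.
Proof.
have a40 : 0 < 4 * a by rewrite mulr_gt0.
have [b20 ab'] : 0 < b / 2 /\ 4 * a < b / 2 by have := a0; have := ab; split; lra.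
pose A := (4 * a) ^+ n; pose B := (b / 2) ^+ n.
have A0 : 0 < A by exact: exprn_gt0.
have AB : A < B by rewrite /A /B ltr_pXn2r// ?nnegrE ltW.
have AB' t : A <= t <= B -> (2 * a) ^+ n < t /\ t < b ^+ n.
  move=> /andP[At tB]; split.
    by apply: lt_le_trans At; rewrite /A ltr_pXn2r//
      ?nnegrE ?ltr_pM2r ?mulr_ge0// ?ltW//; lra.
  by apply: le_lt_trans tB _; rewrite /B ltr_pXn2r// ?nnegrE ?ltW//; lra.
rewrite /lorentz_norm.
have integrand_ge0 t : `]0%R, +oo[%classic t ->
    (0 <= ((t `^ r^-1)%:E * rearrangement h t) `^ alpha * (t^-1)%:E)%E.
  rewrite /= in_itv/= andbT => t0.
  by rewrite mule_ge0 ?poweR_ge0// lee_fin invr_ge0 ltW.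
have inv_ge0 t : (0 <= ((fun t : R => (t^-1)%:E) \_ `[A, B]) t)%E.
  rewrite patchE; case: ifP => // /set_mem; rewrite /= in_itv/=.
  by move=> /andP[/(lt_le_trans A0) t0 _]; rewrite lee_fin invr_ge0 ltW.
pose f (t : R) : \bar R := ((c `^ alpha)%:E *
  ((fun t : R => (t^-1)%:E) \_ `[A, B] t))%E.
have low : (\int[lebesgue_measure]_t f t <=
   \int[lebesgue_measure]_(t in `]0%R, +oo[) (((t `^ r^-1)%:E *
     rearrangement h t) `^ alpha * (t^-1)%:E))%E.
  apply: ge0_le_integral_nonmeasurable => [t|t|t].
  - by rewrite mule_ge0 ?lee_fin ?powR_ge0.
  - exact: integrand_ge0.
  - rewrite /f !patchE; case: ifPn => [|_]; last first.
      rewrite [point]/(0%E) mule0; case: ifPn => // /set_mem; exact: integrand_ge0.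
    move=> /set_mem; rewrite /= in_itv/= => tAB.
    have t0 : 0 < t by case/andP: tAB => /(lt_le_trans A0).
    rewrite mem_set; last by rewrite /= in_itv/= t0.
    rewrite lee_wpmul2r ?lee_fin ?invr_ge0 ?(ltW t0)// -poweR_EFin.
    have cle : (c%:E <= (t `^ r^-1)%:E * rearrangement h t)%E.
      have [t1 t2] := AB' _ tAB.
      have -> : c%:E = ((t `^ r^-1)%:E * (c * t `^ (- r^-1))%:E)%E.
        by rewrite -EFinM mulrCA powRN mulfV ?mulr1// gt_eqF// powR_gt0.
      by rewrite lee_pmul2l// ?lte_fin ?powR_gt0// rearrangement_lower.
    apply: gt0_ler_poweR => //; first exact: ltW.
      by rewrite in_itv/= leey lee_fin (ltW c0).
    by rewrite in_itv/= leey andbT (le_trans _ cle)// lee_fin ltW.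
have intf : (\int[lebesgue_measure]_t f t =
  (c `^ alpha * (n%:R * (ln (b / 2) - ln (4 * a))))%:E)%E.
  rewrite /f ge0_integralZl//; last 2 first.
  - apply/(measurable_restrictT _ _).1 => //; apply/measurable_EFinP.
    by apply: subspace_continuous_measurable_fun => //;
      exact: within_continuous_inv.
  - by rewrite lee_fin powR_ge0.
  rewrite -integral_mkcond integral_inv// EFinM; congr (_ * _%:E)%E.
  by rewrite /A /B !lnXn// [RHS]mulrBr !mulr_natl.
move: low; rewrite intf => low.
have L0 : 0 <= n%:R * (ln (b / 2) - ln (4 * a)).
  by rewrite mulr_ge0// subr_ge0 ler_ln ?posrE// ltW.
apply: le_trans (gt0_ler_poweR _ _ _ low).
- rewrite poweR_EFin [in leRHS]powRM ?powR_ge0// -powRrM mulfV ?gt_eqF//.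
  by rewrite powRr1// ltW.
- by rewrite invr_ge0 ltW.
- by rewrite in_itv/= leey lee_fin mulr_ge0// powR_ge0.
- by rewrite in_itv/= leey andbT (le_trans _ low)// lee_fin mulr_ge0// powR_ge0.
Qed.

End lorentz_lower_bound.

(** * Test functions *)

Section test_functions.
Local Open Scope complex_scope.
Context {R : realType} {n : nat}.
Local Notation lebn := (leb R n).

Definition shell (N : nat) : set (Rn R n) := [set u | 2 ^- N <= supn u < 1].

Definition shell_power (N : nat) (u : Rn R n) : R :=
  supn u `^ (- n%:R) * \1_(shell N) u.

Lemma shellP N u : shell N u -> 2 ^- N <= supn u /\ supn u < 1.
Proof. by move=> /andP[]. Qed.

Lemma measurable_shell N : measurable (shell N).
Proof.
rewrite -[X in measurable X]setTI (_ : shell N = supn @^-1` `[2 ^- N, 1[%classic).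
  by apply: measurable_supn.
by apply/seteqP; split=> x /=; rewrite in_itv.
Qed.

Lemma measurable_shell_power N : measurable_fun setT (shell_power N).
Proof.
apply: measurable_funM.
  exact: measurableT_comp (measurable_powR _) measurable_supn.
by apply: measurable_indic; exact: measurable_shell.
Qed.

Lemma shell_power_ge0 N u : 0 <= shell_power N u.
Proof. by rewrite mulr_ge0 ?powR_ge0// indicE. Qed.

Lemma shell_power_lower N u k : 2 ^- N <= supn u -> supn u < 1 -> supn u <= k ->
  k `^ (- n%:R) <= shell_power N u.
Proof.
move=> h1 h2 h3; rewrite /shell_power indicE mem_set ?mulr1;
  last by rewrite /shell/= h1 h2.
have u0 : 0 < supn u by rewrite (lt_le_trans _ h1)// invr_gt0 exprn_gt0.
have k0 : 0 < k := lt_le_trans u0 h3.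
rewrite !powRN lef_pV2 ?posrE ?powR_gt0//.
by rewrite ge0_ler_powR ?nnegrE// ltW.
Qed.

Lemma shell_power_upper N u : shell_power N u <= (2 ^+ N) `^ n%:R.
Proof.
rewrite /shell_power indicE; have [/set_mem/shellP[h1 h2]|_] :=
  boolP (u \in shell N); last first.
  by rewrite mulr0 powR_ge0.
have N0 : 0 < 2 ^- N :> R by rewrite invr_gt0 exprn_gt0.
rewrite mulr1 powRN -[leRHS]invrK lef_pV2 ?posrE ?invr_gt0 ?powR_gt0 ?exprn_gt0//.
  rewrite !powR_mulrn ?exprn_ge0 ?supn_ge0// -exprVn.
  by apply: lerXn2r => //; rewrite nnegrE ?supn_ge0// ltW.
by rewrite (lt_le_trans N0).
Qed.

(** The new layer 2^-(N+1) <= |u| < 2^-N is covered by a box, on which the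
    function is at most its value on the inner boundary. *)
Lemma shell_powerS N u :
  shell_power N.+1 u <= shell_power N u +
    (2 ^+ N.+1) `^ n%:R * \1_[set u | supn u < 2 ^- N] u.
Proof.
have [h|h] := ltP (supn u) (2 ^- N).
  rewrite [X in _ * X]indicE mem_set// mulr1 (le_trans (shell_power_upper _ _))//.
  by rewrite lerDr shell_power_ge0.
rewrite [X in _ * X]indicE memNset/=; last by rewrite ltNge h.
rewrite mulr0 addr0 /shell_power !indicE ler_wpM2l ?powR_ge0//.
have [/set_mem/shellP[h1 h2]|_] := boolP (u \in shell N.+1); last first.
  by case: (_ \in _).
by rewrite mem_set// /shell/= h h2.
Qed.

(** Each of the N dyadic layers contributes at most 4^n: a height 2^((k+1)n)
    over a box of side 2 * 2^-k. *)
Lemma integral_shell_power N :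
  (\int[lebn]_u (shell_power N u)%:E <= (4 ^+ n * N%:R : R)%:E)%E.
Proof.
have mE (f : Rn R n -> R) : measurable_fun setT f ->
    measurable_fun setT (EFin \o f).
  by move=> ?; exact/measurable_EFinP.
elim: N => [|N IH].
  rewrite integral0_eq ?mulr0// => u _;
    rewrite /shell_power indicE memNset ?mulr0//.
  by rewrite /shell/= expr0 invr1 => /andP[]; rewrite leNgt => /negbTE->.
have mi : measurable_fun setT (\1_[set u : Rn R n | supn u < 2 ^- N] : Rn R n -> R).
  by apply: measurable_indic; exact: measurable_supn_lt.
apply: (@le_trans _ _ (\int[lebn]_u ((shell_power N u)%:E +
    ((2 ^+ N.+1) `^ n%:R)%:E * (\1_[set u | supn u < 2 ^- N]%R u)%:E))%E).
  apply: ge0_le_integral => //.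
  - by move=> u _; rewrite lee_fin shell_power_ge0.
  - by apply: mE; exact: measurable_shell_power.
  - apply: emeasurable_funD; first by apply: mE; exact: measurable_shell_power.
    by apply: emeasurable_funM => //; exact: mE.
  - by move=> u _; rewrite -EFinM -EFinD lee_fin shell_powerS.
rewrite ge0_integralD//; last 3 first.
- by move=> u _; rewrite lee_fin shell_power_ge0.
- by apply: mE; exact: measurable_shell_power.
- by apply: emeasurable_funM => //; exact: mE.
rewrite ge0_integralZl//; last by apply/measurable_EFinP.
rewrite integral_indic ?setIT//; last exact: measurable_supn_lt.
rewrite [X in (_ * X)%E](_ : _ = ((2 * 2 ^- N) ^+ n)%:E); last first.
  by apply: leb_supn_lt; rewrite invr_gt0 exprn_gt0.
rewrite (le_trans (leeD2r _ IH))// -EFinM -EFinD lee_fin.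
rewrite powR_mulrn ?exprn_ge0// -exprMn exprS.
have -> : 2 * 2 ^+ N * (2 * 2 ^- N) = 4 :> R.
  by field; rewrite expf_neq0.
by rewrite -[N.+1%:R]natr1 mulrDr mulr1.
Qed.

Lemma cabs_real (x : R) : cabs x%:C = `|x|.
Proof. by rewrite cabsE /= expr0n/= addr0 sqrtr_sqr. Qed.

Lemma Lp_norm_powR (w : Rn R n -> R) (p : R) : 0 < p -> (forall u, 0 <= w u) ->
  Lp_norm p%:E (fun u => (w u `^ p^-1)%:C) = ((\int[lebn]_u (w u)%:E) `^ p^-1)%E.
Proof.
move=> p0 w0; rewrite /Lp_norm unlock; congr (_ `^ _)%E.
apply: eq_integral => u _.
rewrite cabs_real /= normr_id ger0_norm ?powR_ge0// -powRrM mulVf ?gt_eqF//.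
by rewrite powRr1.
Qed.

Lemma Lp_norm_shell_power (p : R) N : 0 < p ->
  (Lp_norm p%:E (fun u => (shell_power N u `^ p^-1)%:C) <=
   ((4 ^+ n * N%:R : R) `^ p^-1)%:E)%E.
Proof.
move=> p0; rewrite Lp_norm_powR//; last exact: shell_power_ge0.
rewrite -poweR_EFin; apply: gt0_ler_poweR (integral_shell_power N).
- by rewrite invr_ge0 ltW.
- rewrite in_itv/= leey andbT; apply: integral_ge0 => u _.
  by rewrite lee_fin shell_power_ge0.
- by rewrite in_itv/= leey andbT lee_fin mulr_ge0.
Qed.

Lemma Lp_norm_gauss (a : R) : 0 < a ->
  Lp_norm 1%:E (fun u : Rn R n => (gauss a u)%:C) =
    ((Num.sqrt (pi / a) ^+ n)%:E)%E :> \bar R.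
Proof.
move=> a0.
have -> : (fun u : Rn R n => (gauss a u)%:C) =
  (fun u : Rn R n => (gauss a u `^ 1^-1)%:C).
  by apply/funext => u; rewrite invr1 powRr1 ?gauss_ge0.
rewrite Lp_norm_powR//; last exact: gauss_ge0.
rewrite invr1 poweRe1; last by apply: integral_ge0 => u _;
  rewrite lee_fin gauss_ge0.
rewrite rintegrable_EFinE; last exact: integrable_gauss.
have := gauss_fourier 0 (vzero : Rn R n) a0.
rewrite expr0n/= !mul0r oppr0 expR0 mulr1 => <-; congr _%:E.
by apply: eq_Rintegral => u _; rewrite mul0r cos0 mulr1.
Qed.

Lemma Lpy_norm_one : (Lp_norm +oo%E (fun u : Rn R n => (1 : R)%:C) <= 1%:E)%E.
Proof.
rewrite /Lp_norm unlock; case: ifPn => [_|_]; last by rewrite lee_fin.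
apply/ess_supP; apply: nearW => u; rewrite cabs_real /= normr_id normr1//.
Qed.

End test_functions.

(** * Lower bounds for the bilinear potential *)

Section bilinear_mean_bounds.
Local Open Scope complex_scope.
Context {R : realType} {n : nat} {s : R} {G : Rn R n -> R}.
Hypotheses (s0 : 0 < s) (besselG : is_bessel_kernel s G).
Local Notation lebn := (leb R n).
Implicit Types (phi psi : Rn R n -> R) (x y : Rn R n).

Let G0 : forall x, 0 <= G x. Proof. by case: besselG. Qed.
Let intG : lebn.-integrable setT (EFin \o G). Proof. by case: besselG. Qed.

Definition bilinear_mean phi psi x : R :=
  \int[lebn]_y (G y * phi (vsub x y) * psi (vadd x y)).

Lemma bilinear_bessel_real phi psi :
  bilinear_bessel G (fun u => (phi u)%:C) (fun u => (psi u)%:C) =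
  fun x => (bilinear_mean phi psi x)%:C.
Proof.
apply/funext => x; rewrite /bilinear_bessel /cintegral /bilinear_mean.
congr (_ +i* _); first by apply: eq_Rintegral => y _ /=; ring.
transitivity (\int[lebn]_y (0 : R)); last by rewrite Rintegral_cst// mul0r.
by apply: eq_Rintegral => y _ /=; ring.
Qed.

Section bounded_functions.
Variables (phi psi : Rn R n -> R) (K L : R).
Hypotheses (mphi : measurable_fun setT phi) (mpsi : measurable_fun setT psi).
Hypotheses (phi0 : forall u, 0 <= phi u) (psi0 : forall u, 0 <= psi u).

Lemma measurable_bilinear_mean : measurable_fun setT (bilinear_mean phi psi).
Proof.
apply: measurableT_comp; first exact: fine_measurable.
apply: (measurable_fun_fubini_tonelli_F (m2 := lebn)
  (fun z : Rn R n * Rn R n => (G z.2 * phi (vsub z.1 z.2) *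
    psi (vadd z.1 z.2))%:E)).
- apply/measurable_EFinP; apply: measurable_funM; [apply: measurable_funM|].
  + exact: measurableT_comp (rintegrable_measurable intG) measurable_snd.
  + apply: (measurableT_comp mphi); exact: measurable_vsub.
  + apply: (measurableT_comp mpsi); exact: measurable_vadd.
- by move=> z; rewrite lee_fin !mulr_ge0.
Qed.

Lemma integrable_bilinear_mean x :
  (forall u, phi u <= K) -> (forall u, psi u <= L) ->
  lebn.-integrable setT (EFin \o (fun y => G y * phi (vsub x y) * psi (vadd x y))).
Proof.
move=> phiK psiL; apply: (rintegrableM_bounded (k := L)).
- apply: (rintegrableM_bounded (k := K) intG).
    apply: (measurableT_comp mphi); exact: measurable_vsub.
  by move=> y; rewrite ger0_norm.
- apply: (measurableT_comp mpsi); exact: measurable_vadd.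
- by move=> y; rewrite ger0_norm.
Qed.

End bounded_functions.

(** The constant may be taken nonnegative, so that the norms of the factors
    can be replaced by upper bounds A and B. *)
Lemma bessel_bounded_real (p q : \bar R) NZ :
  bessel_bounded G (Lp_norm p) (Lp_norm q) NZ ->
  exists C : R, forall phi psi (A B : R),
    measurable_fun setT phi -> measurable_fun setT psi ->
    (Lp_norm p (fun u => (phi u)%:C) <= A%:E)%E ->
    (Lp_norm q (fun u => (psi u)%:C) <= B%:E)%E ->
    (NZ (fun x => (bilinear_mean phi psi x)%:C) <= (C * (A * B))%:E)%E.
Proof.
case=> C bC; exists `|C| => phi psi A B mphi mpsi pA qB.
have inX (r : \bar R) (f : Rn R n -> R) (D : R) : measurable_fun setT f ->
    (Lp_norm r (fun u : Rn R n => (f u)%:C) <= D%:E)%E ->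
    in_space (Lp_norm r) (fun u : Rn R n => (f u)%:C).
  move=> mf fD; split; last by rewrite (le_lt_trans fD)// ltry.
  by split => //; exact: measurable_cst.
have [_] := bC _ _ (inX p phi A mphi pA) (inX q psi B mpsi qB).
rewrite bilinear_bessel_real => /le_trans; apply.
have p0 : (0 <= Lp_norm p (fun u => (phi u)%:C))%E by exact: Lnorm_ge0.
have q0 : (0 <= Lp_norm q (fun u => (psi u)%:C))%E by exact: Lnorm_ge0.
rewrite EFinM; apply: (@le_trans _ _ (`|C|%:E * (Lp_norm p (fun u => (phi u)%:C) *
   Lp_norm q (fun u => (psi u)%:C)))%E).
  by rewrite lee_wpmul2r ?mule_ge0// lee_fin ler_norm.
by rewrite lee_wpmul2l ?lee_fin// EFinM lee_pmul.
Qed.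

Lemma measurable_shell_powR N (i : R) :
  measurable_fun setT (fun u : Rn R n => shell_power N u `^ i).
Proof. exact: measurableT_comp (measurable_powR _) (measurable_shell_power _). Qed.

Lemma shell_powR_upper N (i : R) (u : Rn R n) : 0 <= i ->
  shell_power N u `^ i <= ((2 ^+ N) `^ n%:R) `^ i.
Proof.
by move=> i0; rewrite ge0_ler_powR ?nnegrE ?shell_power_ge0 ?powR_ge0
  ?shell_power_upper.
Qed.

Lemma shell_powR_lower N (i k : R) (u : Rn R n) : 0 <= i ->
  2 ^- N <= supn u -> supn u < 1 -> supn u <= k ->
  k `^ (- (n%:R * i)) <= shell_power N u `^ i.
Proof.
move=> i0 h1 h2 h3; rewrite -mulNr powRrM.
by rewrite ge0_ler_powR ?nnegrE ?shell_power_ge0 ?powR_ge0 ?shell_power_lower.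
Qed.

(** For |y| < |x| / 2 and x well inside the shell, both x - y and x + y have
    norm between |x| / 2 and 3 |x| / 2, hence lie in the shell, and the two
    weights are at least a multiple of |x|^(-n i) and |x|^(-n j). The
    remaining factor is the mass of G on the ball of radius |x| / 2, at least
    a multiple of |x|^s. *)
Lemma bilinear_mean_shells_lower (i j : R) : (0 < n)%N -> 0 <= i -> 0 <= j ->
  exists2 k, 0 < k & forall N x, 2 * 2 ^- N <= supn x -> supn x < 2 / 3 ->
  k * supn x `^ (- (n%:R * (i + j) - s)) <=
  bilinear_mean (fun u => shell_power N u `^ i) (fun u => shell_power N u `^ j) x.
Proof.
move=> n0 i0 j0; have [c c0 hc] := bessel_ball_mass s0 besselG n0.
exists (c * 2^-1 `^ s * (3 / 2) `^ (- (n%:R * (i + j)))).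
  by rewrite !mulr_gt0// powR_gt0.
move=> N x Nx x1; set rho := supn x in Nx x1 *.
have N0 : 0 < 2 ^- N :> R by rewrite invr_gt0 exprn_gt0.
have r0 : 0 < rho by rewrite (lt_le_trans _ Nx)// mulr_gt0.
pose k1 := (3 / 2 * rho) `^ (- (n%:R * i)).
pose k2 := (3 / 2 * rho) `^ (- (n%:R * j)).
have E := @measurable_supn_lt R n (rho / 2).
apply: (@le_trans _ _ ((k1 * k2) * \int[lebn]_y
  (G y * \1_[set y | supn y < rho / 2] y))).
  apply: (@le_trans _ _ (k1 * k2 * (c * (rho / 2) `^ s))); last first.
    rewrite ler_wpM2l ?mulr_ge0 ?powR_ge0// hc// divr_gt0//=.
    by have := x1; lra.
  have D (t a b : R) : 0 < t -> t `^ (a + b) = t `^ a * t `^ b.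
    by move=> t0; rewrite powRD// (gt_eqF t0) implybT.
  have -> : k1 * k2 = (3 / 2) `^ (- (n%:R * (i + j))) * rho `^ (- (n%:R * (i + j))).
    by rewrite /k1 /k2 -D ?mulr_gt0// -opprD -mulrDr powRM ?(ltW r0).
  rewrite opprB D// powRM ?(ltW r0)//.
  by rewrite le_eqVlt; apply/orP; left; apply/eqP; ring.
have intind : lebn.-integrable setT (EFin \o
  (fun y => G y * \1_[set y | supn y < rho / 2] y)).
  apply: (rintegrableM_bounded (k := 1) intG).
    by apply: measurable_indic.
  by move=> y; rewrite indicE; case: (_ \in _); rewrite ?normr1 ?normr0.
rewrite -RintegralZl//; apply: le_Rintegral => //.
- exact: rintegrableZ.
- exact: (@integrable_bilinear_mean _ _ _ _ (measurable_shell_powR N i)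
    (measurable_shell_powR N j) (fun u => powR_ge0 _ _) (fun u => powR_ge0 _ _) x
    (fun u => shell_powR_upper N u i0) (fun u => shell_powR_upper N u j0)).
- move=> y _; rewrite indicE; have [/set_mem/= yr|_] := boolP (y \in _); last first.
    by rewrite !mulr0 !mulr_ge0 ?powR_ge0.
  have := supn_vsub_ge x y; have := supn_vadd_ge x y.
  have := supn_vsub x y; have := supn_vadd x y; rewrite -/rho => u1 u2 l1 l2.
  rewrite mulr1 mulrC -mulrA ler_wpM2l// ler_pM ?powR_ge0//.
  + by apply: shell_powR_lower => //; lra.
  + by apply: shell_powR_lower => //; lra.
Qed.

(** The general bound at heat time tau = |x|^2: times of that order contribute
    the size |x|^(s-n) that G has at distance |x| from the origin. *)
Lemma gauss_mean_lower_radial : exists2 c, 0 < c & forall a x,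
  0 < supn x <= 1 -> 1 <= a * supn x ^+ 2 ->
  c * Num.sqrt a ^- n * supn x `^ (s - n%:R) <= gauss_mean (G := G) a x.
Proof.
have [c c0 hc] := gauss_mean_lower s0 besselG; exists c => // a x /andP[x0 x1] ax.
have x20 : 0 < supn x ^+ 2 by rewrite exprn_gt0.
have a0 : 0 < a by rewrite -(pmulr_lgt0 _ x20) (lt_le_trans ltr01).
have x21 : 0 < supn x ^+ 2 <= 1 by rewrite x20 exprn_ile1// ltW.
apply: le_trans (hc a (supn x ^+ 2) x x21 ax (dot_le_supn x)).
rewrite -mulrA ler_pM2l// sqrtrM ?(ltW a0)// sqrtr_sqr ger0_norm ?(ltW x0)//.
rewrite -powR_mulrn ?(ltW x0)// -powRrM exprMn invfM mulrCA.
rewrite ler_wpM2l ?invr_ge0 ?exprn_ge0 ?sqrtr_ge0//.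
rewrite powRD ?(gt_eqF x0) ?implybT// powRN powR_mulrn ?(ltW x0)//.
by rewrite mulrCA mulfV// mulr1.
Qed.

Lemma bilinear_mean_gauss_one a x : bilinear_mean (gauss a) (fun=> 1) x =
  gauss_mean (G := G) a (vopp x).
Proof.
apply: eq_Rintegral => y _; rewrite mulr1 /gauss; congr (_ * expR (- (_ * _))).
by apply: eq_bigr => i _; rewrite !tnth_mktuple -mulrNN; congr (_ * _); ring.
Qed.

Lemma integrable_gauss_ball (a rho : R) x : 0 < a ->
  lebn.-integrable setT (EFin \o (fun y => G y * gauss a (vadd x y) *
    \1_[set y | supn (vadd x y) < rho] y)).
Proof.
move=> a0; have ig := integrable_gauss_shift besselG x a0.
apply: (rintegrableM_bounded (k := 1) ig).
  apply: measurable_indic; rewrite -[X in measurable X]setTI.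
  rewrite (_ : [set y | _] = (fun y => vadd x y) @^-1` [set y | supn y < rho])//.
  by apply: measurable_vadd => //; exact: measurable_supn_lt.
by move=> y; rewrite indicE; case: (_ \in _); rewrite ?normr1 ?normr0.
Qed.

(** Away from the ball of radius rho around -x the Gaussian is at most
    e^(-a rho^2), and G has finite total mass. *)
Lemma gauss_mean_tail (a rho : R) x : 0 < a -> 0 <= rho ->
  gauss_mean (G := G) a x <=
  \int[lebn]_y (G y * gauss a (vadd x y) * \1_[set y | supn (vadd x y) < rho] y) +
  expR (- (a * rho ^+ 2)) * \int[lebn]_y G y.
Proof.
move=> a0 r0.
have ig := integrable_gauss_shift besselG x a0.
have ii := integrable_gauss_ball rho x a0.
rewrite -RintegralZl// -RintegralD//; last exact: rintegrableZ.
apply: le_Rintegral => //; first by apply: rintegrableD => //; exact: rintegrableZ.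
move=> y _; rewrite indicE; have [_|] := boolP (y \in _).
  by rewrite mulr1 lerDl mulr_ge0 ?expR_ge0.
move=> /negP yE; have {}yE : rho <= supn (vadd x y).
  by rewrite leNgt; apply/negP => h; apply: yE; rewrite inE.
rewrite mulr0 add0r mulrC ler_wpM2r// ler_expR lerN2 ler_pM2l//.
apply: le_trans (sqr_supn_le_dot _).
by apply: lerXn2r => //; rewrite nnegrE ?supn_ge0.
Qed.

(** An exponential beats a power: e^(a delta) is at least
    (a delta / (n+1))^(n+1), which for large a exceeds any multiple of
    a^n >= sqrt a ^ n. *)
Lemma gauss_scale_exists (delta eps M : R) : 0 < delta -> 0 < eps -> 0 <= M ->
  exists2 a, 1 <= a * delta & expR (- (a * delta)) * M <= eps * Num.sqrt a ^- n.
Proof.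
move=> d0 e0 M0; pose c : R := n.+1%:R / delta.
have c0 : 0 < c by rewrite divr_gt0.
pose T := M * c ^+ n.+1.
have T0 : 0 <= T by rewrite mulr_ge0 ?exprn_ge0// ltW.
pose a := 1 + delta^-1 + T / eps.
have d10 : 0 < delta^-1 by rewrite invr_gt0.
have Te : 0 <= T / eps by rewrite divr_ge0// ltW.
have a1 : 1 <= a by rewrite /a; lra.
have a0 : 0 < a by rewrite (lt_le_trans ltr01).
have aT : T <= a * eps by rewrite -ler_pdivrMr// /a; lra.
exists a; first by rewrite -ler_pdivrMr// mul1r /a; lra.
have sa : Num.sqrt a ^+ n <= a ^+ n.
  apply: lerXn2r; rewrite ?nnegrE ?sqrtr_ge0 ?(ltW a0)//.
  by rewrite -[leRHS]ger0_norm ?(ltW a0)// -sqrtr_sqr ler_wsqrtr// ler_eXnr.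
have s0' : 0 < Num.sqrt a ^+ n by rewrite exprn_gt0// sqrtr_gt0.
rewrite ler_pdivlMr//.
have E : (a / c) ^+ n.+1 <= expR (a * delta).
  have -> : a * delta = n.+1%:R * (a / c).
    by rewrite /c; field; rewrite !gt_eqF.
  rewrite expRM_natl; apply: lerXn2r; rewrite ?nnegrE ?expR_ge0//.
    by rewrite divr_ge0// ltW.
  by apply: le_trans (expR_ge1Dx _); rewrite lerDr.
rewrite expRN -mulrA mulrC ler_pdivrMr ?expR_gt0//.
apply: (@le_trans _ _ (M * a ^+ n)); first by rewrite ler_wpM2l.
apply: (@le_trans _ _ (eps * (a / c) ^+ n.+1)); last by rewrite ler_pM2l.
rewrite expr_div_n mulrA ler_pdivlMr ?exprn_gt0//
  mulrAC -/T exprS mulrA ler_wpM2r//.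
  by rewrite exprn_ge0// ltW.
by rewrite mulrC.
Qed.

(** The Gaussian concentrates at y = -x. For |x + y| < |x| the point x - y =
    2x - (x + y) has norm between |x| and 3 |x|, so there the shell weight is
    at least a multiple of |x|^(-n i), and what remains is the Gaussian
    average of G near -x, up to a tail. The scale a depends on N alone: it
    makes the tail less than half of the main term for every |x| >= 2^-N. *)
Lemma bilinear_mean_shell_gauss_lower (i : R) : s < n%:R -> 0 <= i ->
  exists2 k, 0 < k & forall N, exists2 a, 0 < a & forall x,
  2 ^- N <= supn x -> supn x < 1 / 3 ->
  k * Num.sqrt a ^- n * supn x `^ (- (n%:R * (i + 1) - s)) <=
  bilinear_mean (fun u => shell_power N u `^ i) (gauss a) x.
Proof.
move=> sn i0; have [c c0 hc] := gauss_mean_lower_radial.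
exists (c / 2 * 3 `^ (- (n%:R * i))); first by rewrite mulr_gt0 ?powR_gt0 ?divr_gt0.
move=> N; set rN : R := 2 ^- N.
have rN0 : 0 < rN by rewrite invr_gt0 exprn_gt0.
have M0 : 0 <= \int[lebn]_y G y by exact: Rintegral_ge0.
have [a ad aM] := gauss_scale_exists (exprn_gt0 2 rN0) (divr_gt0 c0
  (ltr0Sn _ 1)) M0.
have a0 : 0 < a by rewrite -(pmulr_lgt0 _ (exprn_gt0 2 rN0)) (lt_le_trans ltr01).
exists a => // x Nx x1; set rho := supn x in Nx x1 *.
have r0 : 0 < rho := lt_le_trans rN0 Nx.
have r1 : rho <= 1 by lra.
have rr : rN ^+ 2 <= rho ^+ 2 by apply: lerXn2r;
  rewrite ?nnegrE ?(ltW rN0) ?(ltW r0).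
have ar : 1 <= a * rho ^+ 2 by rewrite (le_trans ad)// ler_pM2l.
have sa0 : 0 < Num.sqrt a ^- n by rewrite invr_gt0 exprn_gt0// sqrtr_gt0.
have low := hc a x; rewrite -/rho r0 r1 ar in low; have {low} low := low isT isT.
have tail := gauss_mean_tail x a0 (ltW r0).
(* As |x| <= 1 and s < n, the factor |x|^(s-n) is at least 1, so it is enough
   to beat the tail at the smallest radius 2^-N. *)
have small : expR (- (a * rho ^+ 2)) * \int[lebn]_y G y <=
    c / 2 * Num.sqrt a ^- n * rho `^ (s - n%:R).
  apply: (@le_trans _ _ (expR (- (a * rN ^+ 2)) * \int[lebn]_y G y)).
    by rewrite ler_wpM2r// ler_expR lerN2 ler_pM2l.
  rewrite (le_trans aM)// ler_peMr ?mulr_ge0 ?divr_ge0 ?(ltW c0) ?(ltW sa0)//.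
  rewrite -[leLHS](powRr0 rho) -opprB powRN powRr0 -[leLHS]invr1 lef_pV2 ?posrE
    ?powR_gt0//.
  by rewrite -[leRHS](powRr0 rho) ger_powR ?r0// subr_ge0 ltW.
have main : c / 2 * Num.sqrt a ^- n * rho `^ (s - n%:R) <=
  \int[lebn]_y (G y * gauss a (vadd x y) * \1_[set y | supn (vadd x y) < rho] y).
  by move: low tail small; set A := gauss_mean _ _; set B := Rintegral _ _ _;
     set E := expR _ * _; set P := _ `^ _; set S := _ ^- n; lra.
pose k1 := (3 * rho) `^ (- (n%:R * i)).
apply: (@le_trans _ _ (k1 * (c / 2 * Num.sqrt a ^- n * rho `^ (s - n%:R)))).
  have -> : - (n%:R * (i + 1) - s) = - (n%:R * i) + (s - n%:R) by ring.
  rewrite [in leLHS]powRD ?(gt_eqF r0) ?implybT// /k1 powRM ?(ltW r0)//.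
  by rewrite le_eqVlt; apply/orP; left; apply/eqP; ring.
apply: (le_trans (ler_wpM2l (powR_ge0 _ _) main)).
have ii := integrable_gauss_ball rho x a0.
rewrite -RintegralZl//; apply: le_Rintegral => //; first exact: rintegrableZ.
  exact: (@integrable_bilinear_mean _ _ _ _ (measurable_shell_powR N i)
    (measurable_gauss _) (fun u => powR_ge0 _ _) (fun u => gauss_ge0 _ _) x
    (fun u => shell_powR_upper N u i0) (fun u => gauss_le1 u (ltW a0))).
move=> y _; rewrite indicE; have [/set_mem/= yr|_] := boolP (y \in _); last first.
  by rewrite !mulr0 !mulr_ge0 ?powR_ge0 ?gauss_ge0.
rewrite mulr1 mulrA (mulrC k1) ler_wpM2r ?gauss_ge0// ler_wpM2l//.
have e : vsub x y = vsub (vadd x x) (vadd x y).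
  by apply: eq_from_tnth => l; rewrite !tnth_mktuple; ring.
have := supn_vsub_ge (vadd x x) (vadd x y); have := supn_vsub (vadd x x) (vadd x y).
rewrite -e supn_double -/rho => u1 l1.
by apply: shell_powR_lower; rewrite -/rN//; lra.
Qed.

(** The potential of a Gaussian and 1 is itself a Gaussian average of G. The
    exponent a = 4^N makes a |x|^2 >= 1 on the shell. *)
Lemma bilinear_mean_gauss_one_lower :
  exists2 k, 0 < k & forall N, exists2 a, 0 < a &
  forall x, 2 ^- N <= supn x -> supn x < 1 ->
  k * Num.sqrt a ^- n * supn x `^ (- (n%:R - s)) <=
    bilinear_mean (gauss a) (fun=> 1) x.
Proof.
have [c c0 hc] := gauss_mean_lower_radial; exists c => // N; exists ((2 ^+ N) ^+ 2).
  by rewrite !exprn_gt0.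
have rN0 : 0 < 2 ^- N :> R by rewrite invr_gt0 exprn_gt0.
move=> x Nx x1; rewrite bilinear_mean_gauss_one -(supn_vopp x) opprB.
apply: hc; rewrite supn_vopp.
  by rewrite (lt_le_trans rN0 Nx) ltW.
rewrite -exprMn -[leLHS](expr1n _ 2); apply: lerXn2r;
  rewrite ?nnegrE ?mulr_ge0 ?exprn_ge0 ?supn_ge0//.
by rewrite -ler_pdivrMl ?exprn_gt0// mulr1.
Qed.

End bilinear_mean_bounds.

(** * Logarithmic blow-up *)

Section growth.
Context {R : realType}.

Lemma no_power_domination (k K D beta gamma : R) :
  0 < k -> 0 <= beta -> beta < gamma ->
  (forall N : nat, (5 <= N)%N ->
     k * (N%:R * ln 2 - D) `^ gamma <= K * N%:R `^ beta) -> False.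
Proof.
move=> k0 b0 bg H.
have l2 : 0 < ln 2 :> R by rewrite ln_gt0 ?ltr1n.
have g0 : 0 < gamma := le_lt_trans b0 bg.
have d0 : 0 < gamma - beta by rewrite subr_gt0.
pose k' := k * (ln 2 / 2) `^ gamma.
have k'0 : 0 < k' by rewrite mulr_gt0 ?powR_gt0 ?divr_gt0.
pose T := `|K| / k' + 1.
have T0 : 0 < T by rewrite ltr_wpDl// divr_ge0// ltW.
(* A value of N beyond 2 |D| / ln 2 makes N ln 2 - D at least half of N ln 2,
   and one beyond T^(1/(gamma - beta)) makes N^gamma exceed T N^beta. *)
pose X := 5 + `|2 * D / ln 2| + T `^ (gamma - beta)^-1.
pose N := (Num.truncn X).+1.
have XN : X < N%:R by rewrite truncnS_gt.
have n1 := normr_ge0 (2 * D / ln 2).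
have p1 := powR_ge0 T (gamma - beta)^-1.
have N5 : (5 <= N)%N by rewrite -(ler_nat R); apply: ltW; rewrite /X in XN; lra.
have N0 : 0 < N%:R :> R by rewrite ltr0n.
have ND : N%:R * (ln 2 / 2) <= N%:R * ln 2 - D.
  have h : 2 * D / ln 2 <= N%:R.
    by rewrite (le_trans (ler_norm _))// ltW// (le_lt_trans _ XN)// /X; lra.
  by move: h; rewrite ler_pdivrMr//; lra.
have TN : T <= N%:R `^ (gamma - beta).
  have dn : gamma - beta != 0 by rewrite gt_eqF.
  have {1}-> : T = (T `^ (gamma - beta)^-1) `^ (gamma - beta).
    by rewrite -powRrM mulVf// powRr1// ltW.
  rewrite ge0_ler_powR ?nnegrE ?powR_ge0 ?(ltW N0) ?(ltW d0)//.
  by rewrite ltW// (le_lt_trans _ XN)// /X; lra.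
have := H N N5; apply/negP; rewrite -ltNge.
apply: (@lt_le_trans _ _ (k' * N%:R `^ gamma)); last first.
  rewrite /k' -mulrA ler_pM2l// mulrC -powRM ?divr_ge0 ?(ltW l2)//.
  by rewrite ge0_ler_powR ?nnegrE ?mulr_ge0 ?divr_ge0 ?(ltW l2) ?(ltW g0)//
    (le_trans _ ND)// mulr_ge0// divr_ge0// ltW.
have -> : gamma = (gamma - beta) + beta by rewrite subrK.
rewrite powRD ?(gt_eqF N0) ?implybT// mulrA ltr_pM2r ?powR_gt0//.
rewrite (le_lt_trans (ler_norm K))// -ltr_pdivrMl// mulrC (lt_le_trans _ TN)//.
by rewrite /T ltrDl.
Qed.

End growth.

Section blowup.
Local Open Scope complex_scope.
Context {R : realType} {n : nat}.

(** The factor M N is the normalisation a^(-n/2) of a Gaussian brick (or 1):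
    it appears both in the lower bound for phi N and in the norms, and
    cancels. The Lorentz norm then grows at least like (N ln 2 - D)^(1/alpha),
    against an upper bound of order N^beta. *)
Lemma lorentz_blowup (r alpha beta C k b : R) (m : nat)
    (phi : nat -> Rn R n -> R) (M : nat -> R) :
  (0 < n)%N -> 0 < r -> 0 < alpha -> 0 <= beta -> beta < alpha^-1 -> 0 < k ->
  (forall N, (5 <= N)%N -> 8 * (2 ^+ m * 2 ^- N) < b) ->
  (forall N, 0 < M N) -> (forall N, measurable_fun setT (phi N)) ->
  (forall N x, 2 ^+ m * 2 ^- N <= supn x -> supn x < b ->
     k * M N * supn x `^ (- (n%:R / r)) <= phi N x) ->
  (forall N, (5 <= N)%N -> (lorentz_norm r alpha%:E (fun x => (phi N x)%:C) <=
     (C * (M N * N%:R `^ beta))%:E)%E) ->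
  False.
Proof.
move=> n0 r0 a0 b0 ba k0 hb M0 mphi low up.
have nR : 0 < n%:R :> R by rewrite ltr0n.
have bb : 0 < b.
  by apply: lt_trans (hb 5 _) => //; rewrite !mulr_gt0 ?invr_gt0 ?exprn_gt0.
apply: (@no_power_domination _ (k * n%:R `^ alpha^-1) C
  (ln (4 * 2 ^+ m) - ln (b / 2)) beta alpha^-1) => //.
  by rewrite mulr_gt0// powR_gt0.
move=> N N5; have rN0 : 0 < 2 ^+ m * 2 ^- N :> R.
  by rewrite mulr_gt0 ?invr_gt0 ?exprn_gt0.
have kM : 0 < k * M N by rewrite mulr_gt0.
have mc : cmeasurable (fun x => (phi N x)%:C).
  by split; [exact: mphi|exact: measurable_cst].
have low' x : 2 ^+ m * 2 ^- N <= supn x -> supn x < b ->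
    k * M N * supn x `^ (- (n%:R / r)) <= cabs (phi N x)%:C.
  by move=> h1 h2; rewrite cabs_real (le_trans (low _ _ h1 h2))// ler_norm.
have := lorentz_norm_lower n0 r0 a0 kM rN0 (hb N N5) mc low'.
move=> /le_trans/(_ (up N N5)); rewrite lee_fin.
have lnE : ln (4 * (2 ^+ m * 2 ^- N)) = ln (4 * 2 ^+ m) - N%:R * ln 2 :> R.
  rewrite mulrA [LHS]lnM ?posrE ?mulr_gt0 ?invr_gt0 ?exprn_gt0//.
  by congr (_ + _); rewrite lnV ?posrE ?exprn_gt0// lnXn// mulr_natl.
have -> : ln (b / 2) - ln (4 * (2 ^+ m * 2 ^- N)) =
    N%:R * ln 2 - (ln (4 * 2 ^+ m) - ln (b / 2)) :> R by rewrite lnE; ring.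
set L := N%:R * _ - _; have L0 : 0 <= L.
  have : ln (4 * (2 ^+ m * 2 ^- N)) <= ln (b / 2) :> R.
    rewrite ler_ln ?posrE ?mulr_gt0 ?invr_gt0 ?exprn_gt0//.
    by have := hb N N5; set z := 2 ^+ m * _; lra.
  by rewrite lnE /L; lra.
rewrite powRM//.
have -> : k * M N * (n%:R `^ alpha^-1 * L `^ alpha^-1) =
  M N * (k * n%:R `^ alpha^-1 * L `^ alpha^-1) by ring.
by rewrite [C * _]mulrCA ler_pM2l.
Qed.

Lemma shell_room (m N : nat) (b : R) : (5 <= N)%N -> 8 * 2 ^+ m < 32 * b ->
  8 * (2 ^+ m * 2 ^- N) < b.
Proof.
move=> N5 mb; rewrite mulrA ltr_pdivrMr ?exprn_gt0//.
have m0 : 0 < 2 ^+ m :> R by rewrite exprn_gt0.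
have b0 : 0 < b by lra.
have : 2 ^+ 5 <= 2 ^+ N :> R by rewrite ler_weXn2l ?ler1n.
have -> : 2 ^+ 5 = 32 :> R by ring.
by move=> h; rewrite (lt_le_trans mb)// mulrC ler_pM2l.
Qed.

Context {s : R} {G : Rn R n -> R}.
Hypotheses (n0 : (0 < n)%N) (s0 : 0 < s) (sn : s < n%:R).
Hypothesis besselG : is_bessel_kernel s G.
Variables (r alpha : R).
Hypotheses (r0 : 0 < r) (alpha0 : 0 < alpha).

(** The exponents i and j stand for 1/p and 1/q. Either may be 0, for an
    infinite exponent: the test function is then constantly 1, since t^0 = 1
    even at t = 0. *)
Lemma unbounded_shells (p q : \bar R) (i j : R) :
  0 <= i -> 0 <= j -> i + j < alpha^-1 -> n%:R / r = n%:R * (i + j) - s ->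
  (forall N, Lp_norm p (fun u : Rn R n => (shell_power N u `^ i)%:C) <=
     ((4 ^+ n * N%:R : R) `^ i)%:E)%E ->
  (forall N, Lp_norm q (fun u : Rn R n => (shell_power N u `^ j)%:C) <=
     ((4 ^+ n * N%:R : R) `^ j)%:E)%E ->
  ~ bessel_bounded G (Lp_norm p) (Lp_norm q) (lorentz_norm r alpha%:E).
Proof.
move=> i0 j0 ija nr pi_ qj /bessel_bounded_real[C bC].
have [k k0 low] := bilinear_mean_shells_lower s0 besselG n0 i0 j0.
apply: (@lorentz_blowup r alpha (i + j) (C * (4 ^+ n) `^ (i + j)) k (2 / 3) 1
  (fun N => bilinear_mean (G := G) (fun u => shell_power N u `^ i)
    (fun u => shell_power N u `^ j))
  (fun=> 1)) => //.
- exact: addr_ge0.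
- by move=> N N5; apply: shell_room => //; rewrite expr1; lra.
- move=> N; apply: (measurable_bilinear_mean besselG (measurable_shell_powR N i)
    (measurable_shell_powR N j)) => u; exact: powR_ge0.
- by move=> N x h1 h2; rewrite mulr1 nr; apply: low.
- move=> N N5; have := bC _ _ _ _ (measurable_shell_powR N i)
    (measurable_shell_powR N j) (pi_ N) (qj N).
  rewrite -powRD ?mul1r; last first.
    by rewrite (gt_eqF (_ : 0 < 4 ^+ n * N%:R)) ?implybT// mulr_gt0 ?exprn_gt0//
      ltr0n (leq_trans _ N5).
  by rewrite powRM// ?exprn_ge0// mulrA.
Qed.

Lemma unbounded_shell_gauss (p : \bar R) (i : R) :
  0 <= i -> i < alpha^-1 -> n%:R / r = n%:R * (i + 1) - s ->
  (forall N, Lp_norm p (fun u : Rn R n => (shell_power N u `^ i)%:C) <=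
     ((4 ^+ n * N%:R : R) `^ i)%:E)%E ->
  ~ bessel_bounded G (Lp_norm p) (Lp_norm 1%:E) (lorentz_norm r alpha%:E).
Proof.
move=> i0 ia nr pi_ /bessel_bounded_real[C bC].
have [k k0 lowk] := bilinear_mean_shell_gauss_lower s0 besselG sn i0.
have {lowk}[a alow] : exists a : nat -> R, forall N, 0 < a N /\ forall x : Rn R n,
    2 ^- N <= supn x -> supn x < 1 / 3 ->
    k * Num.sqrt (a N) ^- n * supn x `^ (- (n%:R * (i + 1) - s)) <=
    bilinear_mean (G := G) (fun u => shell_power N u `^ i) (gauss (a N)) x.
  by exists (fun N => s2val (cid2 (lowk N))) => N; case: (cid2 (lowk N)).
apply: (@lorentz_blowup r alpha i
  (C * ((4 ^+ n) `^ i * Num.sqrt pi ^+ n)) k (1 / 3) 0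
  (fun N => bilinear_mean (G := G) (fun u => shell_power N u `^ i) (gauss (a N)))
  (fun N => Num.sqrt (a N) ^- n)) => //.
- by move=> N N5; apply: shell_room => //; rewrite expr0; lra.
- by move=> N; rewrite invr_gt0 exprn_gt0// sqrtr_gt0; have [] := alow N.
- move=> N; apply: (measurable_bilinear_mean besselG (measurable_shell_powR N i)
    (measurable_gauss (a N))) => u; [exact: powR_ge0|exact: gauss_ge0].
- by move=> N x; rewrite expr0 mul1r nr; apply: (alow N).2.
- move=> N N5; have [aN0 _] := alow N.
  have := bC _ _ _ _ (measurable_shell_powR N i) (measurable_gauss (a N)) (pi_ N)
    (eq_ind_r (fun z => (z <= _)%E) (lexx _) (Lp_norm_gauss aN0)).
  move=> /le_trans; apply; rewrite lee_fin.
  rewrite sqrtrM ?pi_ge0// sqrtrV ?(ltW aN0)// exprMn exprVn powRM ?exprn_ge0//.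
  by rewrite le_eqVlt; apply/orP; left; apply/eqP; ring.
Qed.

Lemma unbounded_gauss_one : n%:R / r = n%:R - s ->
  ~ bessel_bounded G (Lp_norm 1%:E) (Lp_norm +oo%E) (lorentz_norm r alpha%:E).
Proof.
move=> nr /bessel_bounded_real[C bC].
have [k k0 lowk] := bilinear_mean_gauss_one_lower s0 besselG.
have {lowk}[a alow] : exists a : nat -> R, forall N, 0 < a N /\ forall x : Rn R n,
    2 ^- N <= supn x -> supn x < 1 ->
    k * Num.sqrt (a N) ^- n * supn x `^ (- (n%:R - s)) <=
    bilinear_mean (G := G) (gauss (a N)) (fun=> 1) x.
  by exists (fun N => s2val (cid2 (lowk N))) => N; case: (cid2 (lowk N)).
apply: (@lorentz_blowup r alpha 0 (C * Num.sqrt pi ^+ n) k 1 0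
  (fun N => bilinear_mean (G := G) (gauss (a N)) (fun=> 1))
  (fun N => Num.sqrt (a N) ^- n)) => //.
- by rewrite invr_gt0.
- by move=> N N5; apply: shell_room => //; rewrite expr0; lra.
- by move=> N; rewrite invr_gt0 exprn_gt0// sqrtr_gt0; have [] := alow N.
- move=> N; apply: (measurable_bilinear_mean besselG (measurable_gauss (a N))
    (measurable_cst (1 : R))) => u //; exact: gauss_ge0.
- by move=> N x; rewrite expr0 mul1r nr; apply: (alow N).2.
- move=> N N5; have [aN0 _] := alow N.
  have := bC _ _ _ _ (measurable_gauss (a N)) (measurable_cst (1 : R))
    (eq_ind_r (fun z => (z <= _)%E) (lexx _) (Lp_norm_gauss aN0)) Lpy_norm_one.
  move=> /le_trans; apply; rewrite lee_fin powRr0 !mulr1.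
  rewrite sqrtrM ?pi_ge0// sqrtrV ?(ltW aN0)// exprMn exprVn.
  by rewrite mulrA.
Qed.

End blowup.

(** * The three ranges of exponents *)

Local Close Scope classical_set_scope.
Unset Implicit Arguments.

Theorem lemma7p2 (R : realType) (n : nat) (s : R) (G : Rn R n -> R)
    (p q : \bar R) (r : R) :
  (1 <= n)%N -> 0 < s -> s < n%:R -> is_bessel_kernel s G ->
  (1 <= p)%E -> (1 <= q)%E ->
  ((s / n%:R)%:E < p^-1 + q^-1)%E ->
  (r%:E^-1 = p^-1 + q^-1 - (s / n%:R)%:E)%E ->
  [/\ (1 < p < +oo)%E -> (1 < q < +oo)%E ->
        forall alpha : \bar R, (0 < alpha)%E -> (p^-1 + q^-1 < alpha^-1)%E ->
        ~ bessel_bounded G (Lp_norm p) (Lp_norm q) (lorentz_norm r alpha),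
      (1 < p < (n%:R / s)%:E)%E -> q = 1%E \/ q = +oo%E ->
        forall alpha : \bar R, (0 < alpha < p)%E ->
        ~ bessel_bounded G (Lp_norm p) (Lp_norm q) (lorentz_norm r alpha) &
      p = 1%E -> q = +oo%E ->
        forall alpha : \bar R, (0 < alpha < +oo)%E ->
        ~ bessel_bounded G (Lp_norm p) (Lp_norm q)
            (lorentz_norm (n%:R / (n%:R - s)) alpha)].
Proof.
move=> n0 s0 sn besselG p1 q1 spq rE.
have nR : 0 < n%:R :> R by rewrite ltr0n.
have invE (t : R) : 0 < t -> (t%:E^-1 = (t^-1)%:E)%E.
  by move=> t0; rewrite inver gt_eqF.
(* Multiplying the definition of r by n turns it into the homogeneity
   n / r = n j - s of the lower bounds for the potential, with j = 1/p + 1/q;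
   positivity of r is the hypothesis 1/p + 1/q > s/n. *)
have rP (j : R) : (p^-1 + q^-1 = j%:E)%E -> 0 < r /\ n%:R / r = n%:R * j - s.
  move=> pq; move: rE spq; rewrite pq -EFinB lte_fin => rj sj.
  have r0 : r != 0 by apply/eqP => r0; move: rj; rewrite r0 inve0.
  move: rj; rewrite inver (negbTE r0) => -[rj].
  split; first by rewrite -invr_gt0 rj subr_gt0.
  by rewrite rj mulrBr mulrCA mulfV ?mulr1// gt_eqF.
have LpyN N : (Lp_norm +oo%E (fun u : Rn R n =>
  real_complex R (shell_power N u `^ 0)) <=
    ((4 ^+ n * N%:R : R) `^ 0)%:E)%E.
  by rewrite powRr0; under eq_fun do rewrite powRr0; exact: Lpy_norm_one.
split.
- move=> /andP[gt1p pfin] /andP[gt1q qfin].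
  case: p p1 gt1p pfin spq rE rP => [p| |]// _ gt1p _ spq rE rP.
  case: q q1 gt1q qfin spq rE rP => [q| |]// _ gt1q _ spq rE rP.
  move: gt1p gt1q; rewrite !lte_fin => {}p1 {}q1.
  have p0 : 0 < p := lt_trans ltr01 p1; have q0 : 0 < q := lt_trans ltr01 q1.
  have [|r0 nr] := rP (p^-1 + q^-1); first by rewrite !invE.
  case=> [alpha| |]//.
    rewrite lte_fin => a0; rewrite !invE// -EFinD lte_fin => pqa.
    apply: (unbounded_shells n0 s0 besselG r0 a0 (i := p^-1) (j := q^-1));
      rewrite ?invr_ge0 ?(ltW p0) ?(ltW q0)//.
    + by move=> N; exact: Lp_norm_shell_power.
    + by move=> N; exact: Lp_norm_shell_power.
  (* For alpha = oo the hypothesis would read 1/p + 1/q < 0. *)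
  by move=> _; rewrite invey !invE// -EFinD lte_fin ltNge addr_ge0// invr_ge0 ltW.
- move=> /andP[gt1p pfin].
  case: p p1 gt1p pfin spq rE rP => [p| |]// _ + _ spq rE rP.
  rewrite lte_fin => p1; have p0 : 0 < p := lt_trans ltr01 p1.
  move=> q1oo; case=> [alpha| |]//; last by move=> /andP[_].
  rewrite !lte_fin => /andP[a0 ap].
  have pa : p^-1 < alpha^-1 by rewrite ltf_pV2 ?posrE.
  case: q1oo => qE; rewrite {}qE in q1 spq rE rP *.
    have [|r0 nr] := rP (p^-1 + 1); first by rewrite invE// inve1.
    apply: (unbounded_shell_gauss n0 s0 sn besselG r0 a0 (i := p^-1)) => //.
    + by rewrite invr_ge0 ltW.
    + by move=> N; exact: Lp_norm_shell_power.
  have [|r0 nr] := rP (p^-1 + 0); first by rewrite invE// invey.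
  apply: (unbounded_shells n0 s0 besselG r0 a0 (i := p^-1) (j := 0)) => //.
  + by rewrite invr_ge0 ltW.
  + by rewrite addr0.
  + by move=> N; exact: Lp_norm_shell_power.
- move=> pE qE; rewrite pE qE; case=> [alpha| |]//; last by rewrite ltxx andbF.
  rewrite !lte_fin => /andP[a0 _].
  have ns0 : 0 < n%:R - s by rewrite subr_gt0.
  apply: (unbounded_gauss_one n0 s0 besselG) => //.
    by rewrite divr_gt0.
  by rewrite invf_div mulrCA mulfV ?mulr1// gt_eqF.
Qed.
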